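(* Let $G$ and $W$ be groups with $W\neq\{1\}$, and let $X$ be a nonempty $G$-set. Then the wreath product $W\wr_X G$ is finitely presented if and only if the following three conditions are all satisfied: (i) $W$ and $G$ are finitely presented; (ii) $G$ acts on $X$ with finitely generated stabilizers, i.e. for every $x\in X$ the stabilizer $G_x$ is a finitely generated group; (iii) the product (diagonal) action of $G$ on the cartesian square $X^2$ has finitely many orbits.
   Context: For a group $W$ and a set $X$, $W^{(X)}$ denotes the direct sum of copies of $W$ indexed by $X$, i.e. the group of finitely supported functions $X\to W$ under pointwise multiplication. If $G$ is a group and $X$ is a $G$-set, $G$ acts on $W^{(X)}$ by permutation of factors: $(g\cdot f)(x)=f(g^{-1}x)$. The (permutational) wreath product is the semidirect product $W\wr_X G=W^{(X)}\rtimes G$ for this action. *)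

(* Defs.v *)
From HB Require Import structures.
From mathcomp Require Import all_boot.
From mathcomp Require Import boolp classical_sets functions cardinality.

Set Implicit Arguments.
Unset Strict Implicit.
Unset Printing Implicit Defensive.

(* [groupType] (from mathcomp.boot.monoid) is the type of possibly infinite
   groups.  It includes a [choiceType] structure, which is no restriction on
   the carrier, since [boolp] provides one for every type ([gen_eqMixin],
   [gen_choiceMixin]). *)

Local Open Scope classical_set_scope.
Local Open Scope group_scope.

Section Subgroups.
Variable G : groupType.
Implicit Types (H S : set G).

Definition is_subgroup H :=
  [/\ H 1, forall x y, H x -> H y -> H (x * y) & forall x, H x -> H x^-1].

Definition is_normal_subgroup H :=
  is_subgroup H /\ forall x y, H x -> H (x ^ y).

Definition generated_subgroup S : set G := smallest is_subgroup S.

Definition normal_closure S : set G := smallest is_normal_subgroup S.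

Definition finitely_generated H :=
  exists2 S : set G, finite_set S & H = generated_subgroup S.

End Subgroups.

(* The free group on [T], realized as the reduced words in the letters
   [(x, false)], standing for x, and [(x, true)], standing for x^-1. *)
Section FreeGroup.
Variable T : choiceType.
Implicit Types (a b : T * bool) (u v w : seq (T * bool)).

Definition linv a := (a.1, ~~ a.2).

Definition reduced w := sorted [rel a b | b != linv a] w.

(* left multiplication of a reduced word by a letter *)
Definition lmul a w :=
  if w is b :: w' then if b == linv a then w' else a :: w else [:: a].

Definition wmul u v := foldr lmul v u.

Definition winv w := rev (map linv w).

Lemma linvK : involutive linv.
Proof. by case=> x b; rewrite /linv /= negbK. Qed.

Lemma reduced_lmul a w : reduced w -> reduced (lmul a w).
Proof.
case: w => [|b w] //= rw; case: eqP => [_|/eqP nab]; last by rewrite /= nab.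
exact: path_sorted rw.
Qed.

Lemma reduced_wmul u v : reduced v -> reduced (wmul u v).
Proof. by move=> rv; elim: u => //= a u; apply: reduced_lmul. Qed.

Lemma reduced_winv w : reduced w -> reduced (winv w).
Proof.
rewrite /reduced /winv rev_sorted sorted_map; apply: sub_sorted => a b /=.
by apply: contraNN => /eqP /(can_inj linvK) ->; rewrite linvK.
Qed.

Lemma lmulK a w : reduced w -> lmul a (lmul (linv a) w) = w.
Proof.
case: w => [|b w] /=; first by rewrite eqxx.
rewrite linvK; case: eqP => [->|_ _] /=; last by rewrite eqxx.
by case: w => [|c w] //= /andP[/negPf ->].
Qed.

Lemma wmul_lmul a u w : reduced w -> wmul (lmul a u) w = lmul a (wmul u w).
Proof.
case: u => [|b u] //= rw; case: eqP => [->|] //=.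
by rewrite lmulK // reduced_wmul.
Qed.

Lemma wmulA u v w : reduced w -> wmul u (wmul v w) = wmul (wmul u v) w.
Proof. by move=> rw; elim: u => //= a u IHu; rewrite wmul_lmul // IHu. Qed.

Lemma wmulw0 w : reduced w -> wmul w [::] = w.
Proof.
elim: w => //= a w IHw rw; rewrite IHw; last exact: path_sorted rw.
by case: w rw {IHw} => [|b w] //= /andP[/negPf ->].
Qed.

Lemma wmulVw w : wmul (winv w) w = [::].
Proof.
elim: w => //= a w IHw.
by rewrite /winv /= rev_cons /wmul foldr_rcons /= linvK eqxx.
Qed.

Lemma winvK : involutive winv.
Proof.
move=> w; rewrite /winv map_rev revK -map_comp map_id_in // => a _.
exact: linvK.
Qed.

Record free_group := FreeGroup { fword : seq (T * bool); _ : reduced fword }.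

HB.instance Definition _ := [isSub for fword].
HB.instance Definition _ := [Choice of free_group by <:].

Lemma fwordP (x : free_group) : reduced (fword x). Proof. exact: valP. Qed.

Definition fg_one := FreeGroup (isT : reduced [::]).
Definition fg_inv x := FreeGroup (reduced_winv (fwordP x)).
Definition fg_mul x y := FreeGroup (reduced_wmul (fword x) (fwordP y)).

Lemma fg_mulA : associative fg_mul.
Proof. by move=> x y z; apply/val_inj/wmulA/fwordP. Qed.
Lemma fg_mul1 : left_id fg_one fg_mul. Proof. by move=> x; apply: val_inj. Qed.
Lemma fg_mulr1 : right_id fg_one fg_mul.
Proof. by move=> x; apply/val_inj/wmulw0/fwordP. Qed.
Lemma fg_mulV : left_inverse fg_one fg_inv fg_mul.
Proof. by move=> x; apply/val_inj/wmulVw. Qed.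
Lemma fg_mulrV : right_inverse fg_one fg_inv fg_mul.
Proof.
by move=> x; apply/val_inj; rewrite /= -{1}[fword x]winvK; apply: wmulVw.
Qed.

HB.instance Definition _ := isGroup.Build free_group
  fg_mulA fg_mul1 fg_mulr1 fg_mulV fg_mulrV.

End FreeGroup.

Definition finitely_presented (G : groupType) :=
  exists (n : nat) (R : set (free_group 'I_n))
         (p : {multiplicative free_group 'I_n -> G}),
    [/\ finite_set R, set_surj setT setT p
      & p @^-1` [set 1] = normal_closure R].

Record gset (G : groupType) (X : Type) := GSet {
  act :> G -> X -> X;
  act1 : forall x, act 1 x = x;
  actM : forall g h x, act (g * h) x = act g (act h x) }.

Section GSets.
Variables (G : groupType) (X : Type) (A : gset G X).

Definition stabilizer x : set G := [set g | A g x = x].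

Definition orbit x : set X := range (fun g => A g x).

Definition finitely_many_orbits := finite_set (range orbit).

Definition diag_act g (p : X * X) := (A g p.1, A g p.2).

Lemma diag_act1 p : diag_act 1 p = p.
Proof. by case: p => x y; rewrite /diag_act !act1. Qed.
Lemma diag_actM g h p : diag_act (g * h) p = diag_act g (diag_act h p).
Proof. by rewrite /diag_act !actM. Qed.

Definition diag_gset : gset G (X * X) := GSet diag_act1 diag_actM.

End GSets.

Record aut_action (G N : groupType) := AutAction {
  aut_gset :> gset G N;
  aut_actM : forall g, {morph aut_gset g : u v / u * v} }.

(* [A] is a parameter of the record, so that the group structure below can be
   inferred from the type [sdprod A]. *)
Record sdprod (N G : groupType) (A : aut_action G N) :=
  SDProd { sd_ker : N; sd_top : G }.

Section SemidirectProduct.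
Variables (N G : groupType) (A : aut_action G N).
Local Notation sdprod := (sdprod A).
Local Notation SDProd := (@SDProd N G A).
Implicit Types s t : sdprod.

HB.instance Definition _ := gen_eqMixin sdprod.
HB.instance Definition _ := gen_choiceMixin sdprod.

Definition sd_one := SDProd 1 1.
Definition sd_mul s t :=
  SDProd (sd_ker s * A (sd_top s) (sd_ker t)) (sd_top s * sd_top t).
Definition sd_inv s := SDProd (A (sd_top s)^-1 (sd_ker s)^-1) (sd_top s)^-1.

Lemma aut_act1 g : A g 1 = 1.
Proof. by apply: (mulgI (A g 1)); rewrite -aut_actM !mulg1. Qed.

Lemma sd_mulA : associative sd_mul.
Proof.
by case=> [u g] [v h] [w k]; rewrite /sd_mul /= aut_actM actM !mulgA.
Qed.
Lemma sd_mul1 : left_id sd_one sd_mul.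
Proof. by case=> [u g]; rewrite /sd_mul /= act1 !mul1g. Qed.
Lemma sd_mulr1 : right_id sd_one sd_mul.
Proof. by case=> [u g]; rewrite /sd_mul /= aut_act1 !mulg1. Qed.
Lemma sd_mulV : left_inverse sd_one sd_inv sd_mul.
Proof. by case=> [u g]; rewrite /sd_mul /= -aut_actM !mulVg aut_act1. Qed.
Lemma sd_mulrV : right_inverse sd_one sd_inv sd_mul.
Proof. by case=> [u g]; rewrite /sd_mul /= -actM !mulgV act1 mulgV. Qed.

HB.instance Definition _ := isGroup.Build sdprod
  sd_mulA sd_mul1 sd_mulr1 sd_mulV sd_mulrV.

End SemidirectProduct.

Section DirectSum.
Variables (W : groupType) (X : Type).

Definition gsupport (f : X -> W) : set X := [set x | f x <> 1].

Record dsum := DSum {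
  dsum_fun :> X -> W;
  dsumP : finite_set (gsupport dsum_fun) }.

HB.instance Definition _ := gen_eqMixin dsum.
HB.instance Definition _ := gen_choiceMixin dsum.

Lemma dsum_ext (f g : dsum) : f =1 g -> f = g.
Proof.
case: f g => [f fP] [g gP] /= /funext fg; case: _ / fg gP => gP.
by congr DSum; apply: Prop_irrelevance.
Qed.

Lemma dsum_one_proof : finite_set (gsupport (fun=> 1)).
Proof. by apply: sub_finite_set (finite_set0 X) => x. Qed.
Definition dsum_one := DSum dsum_one_proof.

Lemma dsum_mul_proof (f g : dsum) : finite_set (gsupport (fun x => f x * g x)).
Proof.
have fgP : finite_set (gsupport f `|` gsupport g).
  by rewrite finite_setU; split; apply: dsumP.
apply: sub_finite_set fgP => x fg1.
case: (pselect (f x = 1)) => [f1|]; last by left.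
by right=> g1; apply: fg1; rewrite f1 g1 mul1g.
Qed.
Definition dsum_mul f g := DSum (dsum_mul_proof f g).

Lemma dsum_inv_proof (f : dsum) : finite_set (gsupport (fun x => (f x)^-1)).
Proof.
apply: sub_finite_set (dsumP f) => x /= fV1 f1.
by apply: fV1; rewrite f1 invg1.
Qed.
Definition dsum_inv f := DSum (dsum_inv_proof f).

Lemma dsum_mulA : associative dsum_mul.
Proof. by move=> f g h; apply: dsum_ext => x /=; rewrite mulgA. Qed.
Lemma dsum_mul1 : left_id dsum_one dsum_mul.
Proof. by move=> f; apply: dsum_ext => x /=; rewrite mul1g. Qed.
Lemma dsum_mulr1 : right_id dsum_one dsum_mul.
Proof. by move=> f; apply: dsum_ext => x /=; rewrite mulg1. Qed.
Lemma dsum_mulV : left_inverse dsum_one dsum_inv dsum_mul.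
Proof. by move=> f; apply: dsum_ext => x /=; rewrite mulVg. Qed.
Lemma dsum_mulrV : right_inverse dsum_one dsum_inv dsum_mul.
Proof. by move=> f; apply: dsum_ext => x /=; rewrite mulgV. Qed.

HB.instance Definition _ := isGroup.Build dsum
  dsum_mulA dsum_mul1 dsum_mulr1 dsum_mulV dsum_mulrV.

End DirectSum.

Section WreathProduct.
Variables (G W : groupType) (X : Type) (A : gset G X).

Lemma dsum_act_proof g (f : dsum W X) :
  finite_set (gsupport (fun x => f (A g^-1 x))).
Proof.
apply: sub_finite_set (finite_image (A g) (dsumP f)) => x /= fx.
by exists (A g^-1 x) => //; rewrite -actM mulgV act1.
Qed.
Definition dsum_act g f := DSum (dsum_act_proof g f).

Lemma dsum_act1 f : dsum_act 1 f = f.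
Proof. by apply: dsum_ext => x /=; rewrite invg1 act1. Qed.
Lemma dsum_actM g h f : dsum_act (g * h) f = dsum_act g (dsum_act h f).
Proof. by apply: dsum_ext => x /=; rewrite invgM actM. Qed.
Lemma dsum_act_morph g : {morph dsum_act g : f1 f2 / f1 * f2}.
Proof. by move=> f1 f2; apply: dsum_ext. Qed.

Definition dsum_aut_action : aut_action G (dsum W X) :=
  @AutAction _ _ (GSet dsum_act1 dsum_actM) dsum_act_morph.

Definition wreath : groupType := sdprod dsum_aut_action.

End WreathProduct.

(* Main.v *)
(* Choose representatives of the G-orbits on X and a surjection a : V -> W, and
   let P be the free product of G with one copy of V for each representative.
   The natural map P -> W wr_X G is onto, and its kernel is normally generated
   by the commutators of stabilizers with the corresponding copies of V, the
   commutators of a copy of V with a G-translate of a copy sitting over a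
   different point of X, and the kernel of a in each copy.

   Taking V = W, finitely many of these relators suffice if the stabilizers are
   finitely generated and X^2 has finitely many orbits.

   Conversely, W wr_X G retracts onto G, and if it is finitely generated then
   so is W, and X has finitely many orbits.  Taking V free of finite rank, finite
   presentability implies that finitely many relators D suffice.  Any choice of
   images of G and of the copies of V satisfying D then extends to W wr_X G; the
   three conditions are obtained by mapping to:
   - (V/K) wr_X G, with K normally generated by the kernel relators in D;
   - W wr_Y G, where Y is the set of subsets of G and the chosen point of X is
     sent to the subgroup L generated by the stabilizer elements occurring in D:
     as W_L commutes only with the stabilizer L of this point of Y, L is the
     whole stabilizer;
   - (W wr_W W)^(X^2) x| G, the copy of W at x acting through two non-commuting
     embeddings of W on the coordinates (x, y) and (y, x) respectively, and
     trivially on the orbits of pairs occurring in D: so these are all the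
     orbits off the diagonal. *)
Require Import Defs.
From HB Require Import structures.
From mathcomp Require Import all_boot.
From mathcomp Require Import boolp classical_sets functions cardinality.

Set Implicit Arguments.
Unset Strict Implicit.
Unset Printing Implicit Defensive.

Local Open Scope classical_set_scope.
Local Open Scope group_scope.

(** These morphisms also carry the equation [f 1 = 1], while [finitely_presented] uses merely
    multiplicative maps; [finitely_presentedP] passes between the two. *)
Local Notation "{ 'gmorph' G -> H }" := (UMagmaMorphism.type G%type H%type)
  (at level 0, G at level 98, format "{ 'gmorph'  G  ->  H }") : type_scope.

(** * Subgroups, morphisms, quotients and free groups *)

Section SubgroupTheory.
Variable G : groupType.
Implicit Types (H S N : set G) (x y : G).

Lemma generated_subgroupP S : is_subgroup (generated_subgroup S).
Proof.
split=> [K [[K1 _ _] _] //|x y Sx Sy K KP|x Sx K KP].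
- by case: (KP) => [[_ KM _] _]; exact: KM (Sx K KP) (Sy K KP).
- by case: (KP) => [[_ _ KV] _]; exact: KV (Sx K KP).
Qed.

Lemma normal_closureP S : is_normal_subgroup (normal_closure S).
Proof.
split; last first.
  by move=> x y Sx K KP; case: (KP) => [[_ KJ] _]; exact: KJ (Sx K KP).
split=> [K [[[K1 _ _] _] _] //|x y Sx Sy K KP|x Sx K KP].
- by case: (KP) => [[[_ KM _] _] _]; exact: KM (Sx K KP) (Sy K KP).
- by case: (KP) => [[[_ _ KV] _] _]; exact: KV (Sx K KP).
Qed.

Lemma mem_generated_subgroup S x : S x -> generated_subgroup S x.
Proof. exact: sub_gen_smallest. Qed.

Lemma mem_normal_closure S x : S x -> normal_closure S x.
Proof. exact: sub_gen_smallest. Qed.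

Lemma is_normal_subgroup1 : is_normal_subgroup [set 1 : G].
Proof.
split; first split=> //= [x y -> ->|x ->]; rewrite ?mulg1 ?invg1 //.
by move=> x y /= ->; rewrite conj1g.
Qed.

Lemma normal_closureS S1 S2 :
  S1 `<=` S2 -> normal_closure S1 `<=` normal_closure S2.
Proof. by apply: sub_smallest2r; apply: normal_closureP. Qed.

Lemma normal_closure_compact S (F : set G) :
    finite_set F -> F `<=` normal_closure S ->
  exists2 D, finite_set D & D `<=` S /\ F `<=` normal_closure D.
Proof.
(* The elements lying in the normal closure of a finite subset of [S] form a
   normal subgroup containing [S]. *)
pose K : set G := [set x | exists2 D, finite_set D &
                             D `<=` S /\ normal_closure D x].
have SK : normal_closure S `<=` K.
  apply: smallest_sub => [|x Sx]; last first.
    exists [set x]; first exact: finite_set1.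
    by split=> [_ -> //|]; apply: sub_gen_smallest.
  split; first split.
  - exists set0 => //; split=> // K0 [[[K01 _ _] _] _] //.
  - move=> x y [D fD [DS Dx]] [E fE [ES Ey]].
    exists (D `|` E); first by rewrite finite_setU.
    split; first by rewrite subUset.
    case: (normal_closureP (D `|` E)) => [[_ + _] _]; apply.
      by apply: normal_closureS Dx; apply: subsetUl.
    by apply: normal_closureS Ey; apply: subsetUr.
  - move=> x [D fD [DS Dx]]; exists D => //; split=> //.
    by case: (normal_closureP D) => [[_ _ +] _]; apply.
  - move=> x y [D fD [DS Dx]]; exists D => //; split=> //.
    by case: (normal_closureP D) => [_ +]; apply.
move=> fF FS.
have /choice[d dP] x : exists D, F x ->
    [/\ finite_set D, D `<=` S & normal_closure D x].
  case: (pselect (F x)) => [Fx|nFx]; last by exists set0.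
  by have /SK [D fD [DS Dx]] := FS _ Fx; exists D.
exists (\bigcup_(x in F) d x).
  by apply: bigcup_finite => // x /dP[].
split; first by move=> y [x /dP[_ dS _]]; apply: dS.
move=> x Fx; case: (dP x Fx) => _ _.
by apply: normal_closureS => y dy; exists x.
Qed.

End SubgroupTheory.

Section Morphisms.
Variables G H : groupType.

Section Build.
Variables (f : G -> H) (fM : {morph f : x y / x * y}).

Lemma morph_eq1 : f 1 = 1.
Proof. by apply: (mulgI (f 1)); rewrite -fM !mulg1. Qed.

Definition gmorph_of : {gmorph G -> H} :=
  HB.pack f (isMultiplicative.Build G H f fM)
            (Multiplicative_isUMagmaMorphism.Build G H f morph_eq1).

End Build.

Implicit Types f g : {gmorph G -> H}.

Lemma subgroup_preim f (K : set H) : is_subgroup K -> is_subgroup (f @^-1` K).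
Proof.
case=> K1 KM KV; split=> [|x y Kx Ky|x Kx] /=; rewrite /preimage /=.
- by rewrite gmulf1.
- by rewrite gmulfM; apply: KM.
- by rewrite gmulfV; apply: KV.
Qed.

Lemma normal_preim f (K : set H) :
  is_normal_subgroup K -> is_normal_subgroup (f @^-1` K).
Proof.
case=> sK KJ; split; first exact: subgroup_preim.
by move=> x y Kx; rewrite /preimage /= gmulfJ; apply: KJ.
Qed.

Lemma normal_ker f : is_normal_subgroup (f @^-1` [set 1]).
Proof. exact: normal_preim (is_normal_subgroup1 H). Qed.

Lemma eq_gmorph_subgroup f g : is_subgroup [set x | f x = g x].
Proof.
split=> [|x y /= fx fy|x /= fx]; rewrite /= ?gmulf1 ?gmulfM ?gmulfV //.
  by rewrite fx fy.
by rewrite fx.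
Qed.

Lemma eq_gmorph_gen f g S :
    (forall x, S x -> f x = g x) ->
  forall x, generated_subgroup S x -> f x = g x.
Proof. exact: (smallest_sub (eq_gmorph_subgroup f g)). Qed.

Lemma commute_subgroup f y : is_subgroup [set x | commute (f x) y].
Proof.
split=> [|u v /= fu fv|u /= fu]; rewrite /= ?gmulf1 ?gmulfM ?gmulfV //.
- exact/commute_sym/commute1.
- by apply/commute_sym/commuteM; apply: commute_sym.
- by apply/commute_sym/commuteV/commute_sym.
Qed.

End Morphisms.

Definition gmorph_id (G : groupType) : {gmorph G -> G} := idfun.

Section Factor.
Variables G H Q : groupType.

(** A section [s] of [p] turns [f] into [f \o s], which is multiplicative because [f] is constant on
    the fibres of [p]. *)
Lemma gmorph_factor (p : {gmorph G -> H}) (f : {gmorph G -> Q}) :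
    set_surj setT setT p -> (forall x, p x = 1 -> f x = 1) ->
  exists g : {gmorph H -> Q}, forall x, g (p x) = f x.
Proof.
move=> p_surj kerpf; pose s y := xget 1 [set x | p x = y].
have sK y : p (s y) = y.
  by case: (p_surj y I) => x _ px; apply: (xgetI 1 (px : [set x | p x = y] x)).
have fE x y : p x = p y -> f x = f y.
  move=> pxy; apply/divg1_eq; rewrite -gmulfF; apply: kerpf.
  by rewrite gmulfF pxy divgg.
have fsM : {morph f \o s : x y / x * y}.
  by move=> x y /=; rewrite -gmulfM; apply: fE; rewrite gmulfM !sK.
by exists (gmorph_of fsM) => x /=; apply: fE; rewrite sK.
Qed.

End Factor.

(** * Quotient groups *)

Section CosetRepr.
Variables (G : groupType) (N : set G) (nN : is_normal_subgroup N).

(** [xget] depends only on the set it is given, so this picks one element per coset; the quotient is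
    built on the chosen elements. *)
Definition coset_repr x : G := xget 1 [set y | N (x^-1 * y)].

Let NM x y : N x -> N y -> N (x * y).
Proof. by case: nN => [[_ + _] _]; apply. Qed.
Let NV x : N x -> N x^-1. Proof. by case: nN => [[_ _ +] _]; apply. Qed.

Lemma coset_reprP x : N (x^-1 * coset_repr x).
Proof.
apply: (xgetI 1 (_ : [set y | N (x^-1 * y)] x)) => /=.
by rewrite mulVg; case: nN => [[]].
Qed.

Lemma coset_repr_eq x y : N (x^-1 * y) -> coset_repr x = coset_repr y.
Proof.
move=> xy; congr xget; apply/seteqP; split=> z /= Nz.
  by have := NM (NV xy) Nz; rewrite invgM invgK mulgA mulgK.
by have := NM xy Nz; rewrite mulgA mulgK.
Qed.

End CosetRepr.

(* [nN] is a parameter of the record, so that the group structure below can be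
   inferred from the type [quotient nN]. *)
Record quotient (G : groupType) (N : set G) (nN : is_normal_subgroup N) :=
  Quotient { quotient_val : G; _ : coset_repr N quotient_val = quotient_val }.

Section Quotient.
Variables (G : groupType) (N : set G) (nN : is_normal_subgroup N).
Local Notation quotient := (quotient nN).
Local Notation quotient_val := (@quotient_val G N nN).
Local Notation Quotient := (@Quotient G N nN _).

Let NM x y : N x -> N y -> N (x * y).
Proof. by case: nN => [[_ + _] _]; apply. Qed.
Let NV x : N x -> N x^-1. Proof. by case: nN => [[_ _ +] _]; apply. Qed.
Let NJ x y : N x -> N (x ^ y). Proof. by case: nN => [_]; apply. Qed.

HB.instance Definition _ := gen_eqMixin quotient.
HB.instance Definition _ := gen_choiceMixin quotient.

Lemma quotient_val_inj : injective quotient_val.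
Proof.
by case=> x xP [y yP] /= xy; case: _ / xy yP => yP; congr Quotient;
  apply: Prop_irrelevance.
Qed.

Definition quotient_map x : quotient :=
  Quotient (esym (coset_repr_eq nN (coset_reprP nN x))).

Lemma quotient_map_eq x y : N (x^-1 * y) -> quotient_map x = quotient_map y.
Proof. by move=> xy; apply/quotient_val_inj/coset_repr_eq. Qed.

Lemma quotient_valK : cancel quotient_val quotient_map.
Proof. by case=> x xP; apply: quotient_val_inj. Qed.

Lemma quotient_mapP x y : quotient_map x = quotient_map y -> N (x^-1 * y).
Proof.
move=> /(congr1 quotient_val) /= xy.
have := NM (coset_reprP nN x) (NV (coset_reprP nN y)).
by rewrite xy invgM invgK mulgA mulgK.
Qed.

Definition quotient_mul a b := quotient_map (quotient_val a * quotient_val b).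
Definition quotient_inv a := quotient_map (quotient_val a)^-1.

Lemma quotient_mapM : {morph quotient_map : x y / x * y >-> quotient_mul x y}.
Proof.
move=> x y; apply: quotient_map_eq => /=; rewrite invgM.
have := NM (NJ y (coset_reprP nN x)) (coset_reprP nN y).
by rewrite conjgE !mulgA mulgK.
Qed.

Lemma quotient_mapV x : quotient_map x^-1 = quotient_inv (quotient_map x).
Proof.
apply: quotient_map_eq => /=; rewrite invgK.
have := NV (NJ x^-1 (coset_reprP nN x)).
by rewrite conjgE invgK mulgA mulgA mulgV mul1g invgM invgK.
Qed.

Lemma quotient_mulA : associative quotient_mul.
Proof.
move=> a b c; rewrite -(quotient_valK a) -(quotient_valK b) -(quotient_valK c).
by rewrite -!quotient_mapM mulgA.
Qed.
Lemma quotient_mul1 : left_id (quotient_map 1) quotient_mul.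
Proof. by move=> a; rewrite -(quotient_valK a) -quotient_mapM mul1g. Qed.
Lemma quotient_mulr1 : right_id (quotient_map 1) quotient_mul.
Proof. by move=> a; rewrite -(quotient_valK a) -quotient_mapM mulg1. Qed.
Lemma quotient_mulV : left_inverse (quotient_map 1) quotient_inv quotient_mul.
Proof.
by move=> a; rewrite -(quotient_valK a) -quotient_mapV -quotient_mapM mulVg.
Qed.
Lemma quotient_mulrV : right_inverse (quotient_map 1) quotient_inv quotient_mul.
Proof.
by move=> a; rewrite -(quotient_valK a) -quotient_mapV -quotient_mapM mulgV.
Qed.

HB.instance Definition _ := isGroup.Build quotient
  quotient_mulA quotient_mul1 quotient_mulr1 quotient_mulV quotient_mulrV.

End Quotient.

Lemma quotient_exists (G : groupType) (N : set G) : is_normal_subgroup N ->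
  exists (Q : groupType) (p : {gmorph G -> Q}),
    set_surj setT setT p /\ forall x, p x = 1 <-> N x.
Proof.
move=> nN; exists (quotient nN), (gmorph_of (quotient_mapM nN)).
split=> [a _|x] /=.
  by exists (quotient_val a) => //=; rewrite quotient_valK.
split=> [/esym/(quotient_mapP)|Nx]; first by rewrite invg1 mul1g.
by apply/esym/quotient_map_eq; rewrite invg1 mul1g.
Qed.

(** * Universal property of free groups *)

Section FreeGroupTheory.
Variables (T : choiceType) (H : groupType).

Definition letter_val (e : T -> H) (a : T * bool) :=
  if a.2 then (e a.1)^-1 else e a.1.

Definition word_val e (w : seq (T * bool)) := \prod_(a <- w) letter_val e a.

Lemma letter_val_linv e a : letter_val e (linv a) = (letter_val e a)^-1.
Proof. by case: a => x [] /=; rewrite /letter_val /= ?invgK. Qed.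

Lemma word_val_lmul e a w :
  word_val e (lmul a w) = letter_val e a * word_val e w.
Proof.
rewrite /word_val; case: w => [|b w] /=.
  by rewrite big_seq1 big_nil mulg1.
rewrite big_cons; case: eqP => [->|_]; last by rewrite !big_cons.
by rewrite letter_val_linv mulgA mulgV mul1g.
Qed.

Lemma word_val_wmul e u v : word_val e (wmul u v) = word_val e u * word_val e v.
Proof.
elim: u => [|a u IHu] /=; first by rewrite /word_val big_nil mul1g.
by rewrite word_val_lmul IHu mulgA /word_val big_cons.
Qed.

Lemma free_lift_morph e :
  {morph (fun x : free_group T => word_val e (fword x)) : x y / x * y}.
Proof. by move=> x y; apply: word_val_wmul. Qed.

Definition free_gen (x : T) : free_group T :=
  FreeGroup (isT : reduced [:: (x, false)]).

Fact free_lift_subproof e :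
  {f : {gmorph free_group T -> H} | forall x, f (free_gen x) = e x}.
Proof.
exists (gmorph_of (free_lift_morph e)) => x.
by rewrite /= /word_val big_seq1.
Qed.
Definition free_lift e := sval (free_lift_subproof e).

Lemma free_liftE e x : free_lift e (free_gen x) = e x.
Proof. exact: (svalP (free_lift_subproof e)). Qed.

Lemma free_group_gen (K : set (free_group T)) :
  is_subgroup K -> (forall x, K (free_gen x)) -> forall u, K u.
Proof.
case=> K1 KM KV Kgen [w rw]; elim: w rw => [|a w IHw] rw.
  by rewrite (_ : FreeGroup rw = 1) //; apply: val_inj.
have rw' : reduced w by apply: path_sorted rw.
pose l : free_group T := FreeGroup (isT : reduced [:: a]).
rewrite (_ : FreeGroup rw = l * FreeGroup rw').
  apply: KM => //; rewrite {}/l; case: a rw => x [] rw; last exact: Kgen.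
  rewrite (_ : FreeGroup _ = (free_gen x)^-1); last exact: val_inj.
  exact/KV/Kgen.
(* The word is reduced, so multiplying [w] by its first letter [a] causes no cancellation. *)
apply: val_inj => /=; case: w rw {rw' IHw} => [|b w] //= /andP[/negPf -> //].
Qed.

Lemma eq_free_gmorph (f g : {gmorph free_group T -> H}) :
  (forall x, f (free_gen x) = g (free_gen x)) -> f =1 g.
Proof. exact: free_group_gen (eq_gmorph_subgroup f g). Qed.

End FreeGroupTheory.

(** * Finite presentations *)

Section FinitePresentation.
Implicit Types G H P : groupType.

Lemma finitely_presentedP G :
  finitely_presented G <->
  exists (n : nat) (R : set (free_group 'I_n))
         (p : {gmorph free_group 'I_n -> G}),
    [/\ finite_set R, set_surj setT setT p
      & forall u, p u = 1 <-> normal_closure R u].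
Proof.
split=> -[n [R [p [fR p_surj pR]]]].
  exists n, R, (gmorph_of (@gmulfM _ _ p)); split=> // u.
  by rewrite -pR.
by exists n, R, p; split=> //; apply/seteqP; split=> u /pR.
Qed.

Lemma finitely_generatedP G :
  finitely_generated [set: G] <->
  exists (n : nat) (p : {gmorph free_group 'I_n -> G}), set_surj setT setT p.
Proof.
split=> [[S fS GS]|[n [p p_surj]]].
  have /finite_seqP[s Ss] := fS.
  pose p : {gmorph free_group 'I_(size s) -> G} :=
    free_lift (fun i : 'I_(size s) => nth 1 s i).
  exists (size s), p => x _.
  have : generated_subgroup S x by rewrite -GS.
  pose K : set G := [set y | exists u, p u = y].
  suff SK : generated_subgroup S `<=` K by move=> /SK [u]; exists u.
  apply: smallest_sub => [|y Sy].
    split=> [|_ _ [u <-] [v <-]|_ [u <-]].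
    - by exists 1; rewrite gmulf1.
    - by exists (u * v); rewrite gmulfM.
    - by exists u^-1; rewrite gmulfV.
  have sy : y \in s by move: Sy; rewrite Ss /=; apply.
  have si : (index y s < size s)%N by rewrite index_mem.
  exists (free_gen (Ordinal si)); rewrite free_liftE.
  exact: nth_index.
exists (range (fun i => p (free_gen i))).
  exact/finite_image/finite_finset.
apply/seteqP; split=> // x _; case: (p_surj x I) => u _ <- {x}.
apply: (free_group_gen
  (subgroup_preim p (generated_subgroupP (range (fun i => p (free_gen i)))))).
by move=> i; apply: mem_generated_subgroup; exists i.
Qed.

Lemma finitely_presented_fg G :
  finitely_presented G -> finitely_generated [set: G].
Proof.
move=> /finitely_presentedP[n [_ [p [_ p_surj _]]]].
by apply/finitely_generatedP; exists n, p.
Qed.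

(** The kernel of [q \o p] is normally generated by the old relators [R] together with lifts of the
    elements of [S]. *)
Lemma finitely_presented_quotient P G (q : {gmorph P -> G}) (S : set P) :
    finitely_presented P -> set_surj setT setT q -> finite_set S ->
    (forall x, q x = 1 <-> normal_closure S x) ->
  finitely_presented G.
Proof.
move=> /finitely_presentedP[n [R [p [fR p_surj pR]]]] q_surj fS qS.
have /choice[l lK] x : exists u, p u = x.
  by case: (p_surj x I) => u _ <-; exists u.
pose R' := R `|` l @` S.
apply/finitely_presentedP; exists n, R', (q \o p); split.
- by rewrite finite_setU; split=> //; apply: finite_image.
- move=> y _; case: (q_surj y I) => x _ <-; exists (l x) => //=.
  by rewrite lK.
(* Membership in the normal closure is tested in the quotient by it: [r] factors through [p], and
   the resulting [s] kills [S], hence the kernel of [q]. *)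
have [Q [r [_ rR']]] := quotient_exists (normal_closureP R').
have [|s sE] := gmorph_factor (f := r) p_surj.
  by move=> u /pR Ru; apply/rR'; apply: normal_closureS Ru; apply: subsetUl.
have Ss x : normal_closure S x -> s x = 1.
  move: x; apply: smallest_sub => [|x Sx]; first exact: normal_ker.
  rewrite /preimage /= -[x]lK sE; apply/rR'; apply: mem_normal_closure.
  by right; exists x.
move=> u; split=> [/qS/Ss|]; first by rewrite sE => /rR'.
apply: (smallest_sub (normal_ker (q \o p))) => v [Rv|[x Sx <-]].
  rewrite /preimage /= (_ : p v = 1) ?gmulf1 //.
  by apply/pR; apply: mem_normal_closure.
by rewrite /preimage /= lK; apply/qS; apply: mem_normal_closure.
Qed.

(** Finite presentability does not depend on the finite generating set. The presentation of [G] is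
    lifted to [t]; [S] consists of the lifted relators and, for each generator [y] of [P], its
    discrepancy from the lift of [q y]. *)
Lemma finitely_presented_ker P G (q : {gmorph P -> G}) :
    finitely_generated [set: P] -> finitely_presented G ->
    set_surj setT setT q ->
  exists2 S : set P, finite_set S & forall x, q x = 1 <-> normal_closure S x.
Proof.
move=> [Y fY PY] /finitely_presentedP[n [R [p [fR p_surj pR]]]] q_surj.
have /choice[l lK] x : exists y, q y = x.
  by case: (q_surj x I) => y _ <-; exists y.
have /choice[k kK] x : exists u, p u = x.
  by case: (p_surj x I) => u _ <-; exists u.
pose t : {gmorph free_group 'I_n -> P} :=
  free_lift (fun i => l (p (free_gen i))).
have qt u : q (t u) = p u.
  by apply: (eq_free_gmorph (f := q \o t)) => i /=; rewrite [t _]free_liftE lK.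
pose S := t @` R `|` (fun y => y^-1 * t (k (q y))) @` Y.
have Sq x : normal_closure S x -> q x = 1.
  apply: (smallest_sub (normal_ker q)) => _ [[u Ru <-]|[y _ <-]].
    by rewrite /preimage /= qt; apply/pR; apply: mem_normal_closure.
  by rewrite /preimage /= gmulfM qt kK gmulfV mulVg.
exists S; first by rewrite finite_setU; split; apply: finite_image.
have [Q [r [_ rS]]] := quotient_exists (normal_closureP S).
have [|s sE] := gmorph_factor (f := r \o t) p_surj.
  move=> u /pR Ru /=; suff: normal_closure R u -> (r \o t) u = 1 by apply.
  apply: (smallest_sub (normal_ker (r \o t))) => v Rv.
  by apply/rS; apply: mem_normal_closure; left; exists v.
(* The class of [x] modulo [S] is recovered from [q x], so the kernel of [q] lies in the normal
   closure of [S]. *)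
have sq x : s (q x) = r x.
  have : generated_subgroup Y x by rewrite -PY.
  apply: (eq_gmorph_gen (f := s \o q)) => y Yy /=.
  rewrite -[q y]kK sE /=; apply/esym/divg1_eq; rewrite -gmulfF.
  apply/rS; case: (normal_closureP S) => -[_ _ SV] SJ.
  have Sy : normal_closure S (y^-1 * t (k (q y))).
    by apply: mem_normal_closure; right; exists y.
  by have := SV _ (SJ _ y^-1 Sy); rewrite conjgE invgK mulgA mulgA mulgV mul1g
    invgM invgK.
move=> x; split=> [qx|]; last exact: Sq.
by apply/rS; rewrite -sq qx gmulf1.
Qed.

(** Modulo the elements [y^-1 * s (q y)] for generators [y], every [x] equals [s (q x)]; hence they
    normally generate the kernel of [q]. *)
Lemma finitely_presented_retract P G (q : {gmorph P -> G})
    (s : {gmorph G -> P}) :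
  finitely_presented P -> cancel s q -> finitely_presented G.
Proof.
move=> Pfp sK; have [Y fY PY] := finitely_presented_fg Pfp.
have q_surj : set_surj setT setT q by move=> x _; exists (s x); rewrite ?sK.
pose S := (fun y => y^-1 * s (q y)) @` Y.
apply: (finitely_presented_quotient (S := S) Pfp q_surj) => [|x].
  exact: finite_image.
have [Q [r [_ rS]]] := quotient_exists (normal_closureP S).
split=> [qx|].
  apply/rS; have -> : r x = r (s (q x)); last by rewrite qx !gmulf1.
  have : generated_subgroup Y x by rewrite -PY.
  apply: (eq_gmorph_gen (g := r \o (s \o q))) => y Yy /=.
  apply: (mulgI (r y)^-1); rewrite mulVg -gmulfV -gmulfM; apply/esym/rS.
  by apply: mem_normal_closure; exists y.
apply: (smallest_sub (normal_ker q)) => _ [y _ <-].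
by rewrite /preimage /= gmulfM sK gmulfV mulVg.
Qed.

Lemma free_group_fp n : finitely_presented (free_group 'I_n).
Proof.
apply/finitely_presentedP; exists n, set0, (gmorph_id _).
split=> [//|x _|u]; first by exists x.
split=> [/= ->|].
  by case: (normal_closureP (@set0 (free_group 'I_n))) => -[].
by apply: (smallest_sub (is_normal_subgroup1 _)).
Qed.

(** This is the free product, with generators and relators put side by side. It is recorded by
    generation and its mapping property, not by normal forms. *)
Lemma coproduct_exists G H : finitely_presented G -> finitely_presented H ->
  exists (P : groupType) (i : {gmorph G -> P}) (j : {gmorph H -> P}),
  [/\ finitely_presented P,
      forall K : set P, is_subgroup K ->
        (forall x, K (i x)) -> (forall y, K (j y)) -> forall z, K z
    & forall (Q : groupType) (f : {gmorph G -> Q}) (g : {gmorph H -> Q}),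
        exists h : {gmorph P -> Q}, h \o i =1 f /\ h \o j =1 g].
Proof.
move=> /finitely_presentedP[n [R [p [fR p_surj pR]]]].
move=> /finitely_presentedP[m [R' [p' [fR' p'_surj p'R']]]].
pose F := free_group 'I_(n + m).
pose u : {gmorph free_group 'I_n -> F} :=
  free_lift (fun i => free_gen (lshift m i)).
pose v : {gmorph free_group 'I_m -> F} :=
  free_lift (fun i => free_gen (rshift n i)).
pose S := u @` R `|` v @` R'.
have fS : finite_set S by rewrite finite_setU; split; apply: finite_image.
have [P [r [r_surj rS]]] := quotient_exists (normal_closureP S).
have [|i iE] := gmorph_factor (f := r \o u) p_surj.
  move=> x /pR; apply: (smallest_sub (normal_ker (r \o u))) => y Ry.
  by apply/rS; apply: mem_normal_closure; left; exists y.
have [|j jE] := gmorph_factor (f := r \o v) p'_surj.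
  move=> x /p'R'; apply: (smallest_sub (normal_ker (r \o v))) => y Ry.
  by apply/rS; apply: mem_normal_closure; right; exists y.
exists P, i, j; split.
- exact: finitely_presented_quotient (free_group_fp _) r_surj fS rS.
- move=> K sK Ki Kj z; case: (r_surj z I) => x _ <- {z}.
  apply: (free_group_gen (subgroup_preim r sK)) => k.
  rewrite /preimage /=; case: (splitP k) => l kl.
    have <- : u (free_gen l) = free_gen k.
      by rewrite [u _]free_liftE; congr free_gen; apply: val_inj.
    by have := Ki (p (free_gen l)); rewrite iE.
  have <- : v (free_gen l) = free_gen k.
    by rewrite [v _]free_liftE; congr free_gen; apply: val_inj.
  by have := Kj (p' (free_gen l)); rewrite jE.
move=> Q f g.
pose h0 : {gmorph F -> Q} :=
  free_lift (fun k : 'I_(n + m) => match fintype.split k with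
  | inl a => f (p (free_gen a)) | inr b => g (p' (free_gen b)) end).
have h0u x : h0 (u x) = f (p x).
  apply: (eq_free_gmorph (f := h0 \o u) (g := f \o p)) => k /=.
  by rewrite !free_liftE (unsplitK (inl k)).
have h0v x : h0 (v x) = g (p' x).
  apply: (eq_free_gmorph (f := h0 \o v) (g := g \o p')) => k /=.
  by rewrite !free_liftE (unsplitK (inr k)).
have [|h hE] := gmorph_factor (f := h0) r_surj.
  move=> x /rS; apply: (smallest_sub (normal_ker h0)) => _ [] [y Ry <-].
    rewrite /preimage /= h0u (_ : p y = 1) ?gmulf1 //.
    by apply/pR; apply: mem_normal_closure.
  rewrite /preimage /= h0v (_ : p' y = 1) ?gmulf1 //.
  by apply/p'R'; apply: mem_normal_closure.
exists h; split=> x /=.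
  by case: (p_surj x I) => y _ <-; rewrite iE /= hE h0u.
by case: (p'_surj x I) => y _ <-; rewrite jE /= hE h0v.
Qed.

Lemma coproduct_family_exists (X : eqType) (xs : seq X) G V :
    uniq xs -> finitely_presented G -> finitely_presented V ->
  exists (P : groupType) (i : {gmorph G -> P}) (j : X -> {gmorph V -> P}),
  [/\ finitely_presented P,
      forall K : set P, is_subgroup K -> (forall g, K (i g)) ->
        (forall x v, x \in xs -> K (j x v)) -> forall z, K z
    & forall (Q : groupType) (f : {gmorph G -> Q}) (k : X -> {gmorph V -> Q}),
        exists h : {gmorph P -> Q},
          h \o i =1 f /\ forall x, x \in xs -> h \o j x =1 k x].
Proof.
move=> + Gfp Vfp; elim: xs => [_|x xs IHxs /= /andP[nx us]].
  exists G, (gmorph_id _).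
  (* The values of [j] off the list are dummies; here all of them are trivial. *)
  have triv (v w : V) : 1 = 1 * 1 :> G by rewrite mulg1.
  exists (fun=> gmorph_of triv); split=> // Q f k.
  by exists f.
have [P [i [j [Pfp genP uniP]]]] := IHxs us.
have [P' [i' [j' [P'fp genP' uniP']]]] := coproduct_exists Pfp Vfp.
exists P', (i' \o i), (fun y => if y == x then j' else i' \o j y); split=> //.
- move=> K sK Ki Kj; apply: genP' => // [y|v]; last first.
    by have := Kj x v (mem_head _ _); rewrite eqxx.
  apply: (genP (i' @^-1` K)) => // [|y' v xs_y']; first exact: subgroup_preim.
  have := Kj y' v; rewrite inE xs_y' orbT => /(_ isT).
  by case: eqP => // xy'; rewrite -xy' xs_y' in nx.
move=> Q f k; have [h [hi hj]] := uniP Q f k.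
have [h' [h'i' h'j']] := uniP' Q h (k x).
exists h'; split=> [g|y]; first exact: etrans (h'i' _) (hi g).
rewrite inE => /predU1P[->|xs_y] v /=; first by rewrite eqxx; apply: h'j'.
case: eqP => [yx|_]; first by rewrite -yx xs_y in nx.
exact: etrans (h'i' _) (hj y xs_y v).
Qed.

End FinitePresentation.

(** * Direct sums and wreath products *)

Section CommutingProducts.
Variables (X : eqType) (Q : groupType).
Implicit Types (F E : X -> Q) (s u : seq X).

Lemma prodg_rem F s x :
    (forall y z, y != z -> commute (F y) (F z)) -> uniq s -> x \in s ->
  \prod_(y <- s) F y = F x * \prod_(y <- rem x s) F y.
Proof.
move=> cF; elim: s => //= a s IHs /andP[sa us]; rewrite big_cons inE.
have [-> _|xa /= sx] := eqVneq x a; first by [].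
by rewrite big_cons IHs // !mulgA (cF a x) // eq_sym.
Qed.

(** As the factors commute, the head [a] of [s] can be moved to the front of [u] and split off from
    both products. *)
Lemma prodg_supp F s u :
    (forall y z, y != z -> commute (F y) (F z)) -> uniq s -> uniq u ->
    (forall x, x \notin s -> F x = 1) -> (forall x, x \notin u -> F x = 1) ->
  \prod_(x <- s) F x = \prod_(x <- u) F x.
Proof.
elim: s F u => [|a s IHs] F u cF.
  by move=> _ _ F1 _; rewrite big_nil big1_seq // => x _; apply: F1.
move=> /= /andP[sa us] uu F1s F1u.
have cons_s (E : X -> Q) (x : X) : x \notin s -> x != a -> x \notin a :: s.
  by move=> xs xa; rewrite inE negb_or xa.
case: (boolP (a \in u)) => ua; last first.
  rewrite big_cons F1u // mul1g; apply: IHs => // x xs.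
  by have [-> |xa] := eqVneq x a; [apply: F1u|apply/F1s/cons_s].
rewrite big_cons (prodg_rem cF uu ua); congr (_ * _).
(* Neither [s] nor [rem a u] contains [a], so resetting the value there to 1 preserves both products
   and makes both lists contain the support. *)
pose F' x := if x == a then 1 else F x.
have F'E r : a \notin r -> \prod_(x <- r) F x = \prod_(x <- r) F' x.
  move=> ra; rewrite !big_seq; apply: eq_bigr => x rx.
  by rewrite /F'; case: eqP => // xa; rewrite -xa rx in ra.
rewrite !F'E ?mem_rem_uniqF //; apply: IHs => // [y z yz||x xs|x].
- rewrite /F'; case: eqP => _; first exact/commute_sym/commute1.
  by case: eqP => _; [apply: commute1|apply: cF].
- exact: rem_uniq.
- by rewrite /F'; case: eqP => // /eqP xa; apply/F1s/cons_s.
by rewrite mem_rem_uniq // inE /F'; case: eqP => //= _; apply: F1u.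
Qed.

Lemma prodgM_commuting F E s :
    uniq s -> (forall x y, x != y -> commute (F x) (E y)) ->
  \prod_(x <- s) (F x * E x) = \prod_(x <- s) F x * \prod_(x <- s) E x.
Proof.
move=> + cFE; elim: s => [|a s IHs] /=; first by rewrite !big_nil mulg1.
move=> /andP[sa us]; rewrite !big_cons IHs // !mulgA; congr (_ * _).
rewrite -!mulgA; congr (_ * _).
rewrite !big_seq; apply: commute_prod => x sx.
apply/commute_sym/cFE; apply: contraNneq sa => <- //.
Qed.

End CommutingProducts.

Section DirectSumTheory.
Variables (W : groupType) (X : choiceType).
Implicit Types (x y : X) (w : W) (f : dsum W X).

Lemma dsum_inj_proof x w :
  finite_set (gsupport (fun y => if y == x then w else 1)).
Proof.
apply: sub_finite_set (finite_set1 x) => y.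
by rewrite /gsupport /=; case: eqP.
Qed.

Lemma dsum_inj_morph x :
  {morph (fun w => DSum (dsum_inj_proof x w)) : v w / v * w}.
Proof.
by move=> v w; apply: dsum_ext => y /=; case: eqP => //; rewrite mulg1.
Qed.

Definition dsum_inj x : {gmorph W -> dsum W X} := gmorph_of (dsum_inj_morph x).

Lemma dsum_inj_commute x y v w :
  x != y -> commute (dsum_inj x v) (dsum_inj y w).
Proof.
move=> xy; apply: dsum_ext => z /=.
by case: eqP => [->|]; rewrite ?(negPf xy) mulg1 mul1g.
Qed.

Lemma dsum_eval_morph x : {morph (fun f : dsum W X => f x) : f g / f * g}.
Proof. by []. Qed.

Definition dsum_eval x : {gmorph dsum W X -> W} :=
  gmorph_of (dsum_eval_morph x).

Definition dsum_supp f : seq X := finmap.enum_fset (fset_set (gsupport f)).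

Lemma dsum_supp_uniq f : uniq (dsum_supp f).
Proof. exact: finmap.fset_uniq. Qed.

Lemma dsum_suppN f x : x \notin dsum_supp f -> f x = 1.
Proof.
move=> xf; apply: contrapT => fx; case/negP: xf.
have -> : (x \in dsum_supp f) = (x \in gsupport f).
  exact: (in_fset_set (dsumP f) x).
by rewrite inE.
Qed.

Section Lift.
Variables (Q : groupType) (k : X -> {gmorph W -> Q}).
Hypothesis k_commute : forall x y v w, x != y -> commute (k x v) (k y w).

Let lift f := \prod_(x <- dsum_supp f) k x (f x).

Lemma dsum_lift_supp f s : uniq s -> (forall x, x \notin s -> f x = 1) ->
  lift f = \prod_(x <- s) k x (f x).
Proof.
move=> us f1; apply: prodg_supp => // [y z|||].
- exact: k_commute.
- exact: dsum_supp_uniq.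
- by move=> x /dsum_suppN ->; rewrite gmulf1.
- by move=> x /f1 ->; rewrite gmulf1.
Qed.

Lemma dsum_lift_morph : {morph lift : f g / f * g}.
Proof.
move=> f g; pose s := undup (dsum_supp f ++ dsum_supp g).
have us : uniq s by apply: undup_uniq.
have f1 x : x \notin s -> f x = 1.
  by rewrite mem_undup mem_cat negb_or => /andP[/dsum_suppN].
have g1 x : x \notin s -> g x = 1.
  by rewrite mem_undup mem_cat negb_or => /andP[_ /dsum_suppN].
rewrite !(@dsum_lift_supp _ s) // => [|x sx]; last first.
  by rewrite /= f1 // g1 // mulg1.
rewrite -prodgM_commuting // => [|x y]; last exact: k_commute.
by apply: eq_bigr => x _; rewrite -gmulfM.
Qed.

(** A finitely supported [f] goes to the product of the [k x (f x)], whose order is immaterial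
    because distinct copies commute. *)
Lemma dsum_lift_exists :
  exists h : {gmorph dsum W X -> Q}, forall x w, h (dsum_inj x w) = k x w.
Proof.
exists (gmorph_of dsum_lift_morph) => x w /=.
rewrite (@dsum_lift_supp _ [:: x]) ?big_seq1 // => [|y].
  by rewrite /= eqxx.
by rewrite inE /= => /negPf ->.
Qed.

End Lift.

Lemma dsum_gen (K : set (dsum W X)) :
  is_subgroup K -> (forall x w, K (dsum_inj x w)) -> forall f, K f.
Proof.
move=> [K1 KM _] Kinj f.
have -> : f = \prod_(x <- dsum_supp f) dsum_inj x (f x).
  apply: dsum_ext => y; rewrite -[RHS]/(dsum_eval y _) gmulf_prod /=.
  case: (boolP (y \in dsum_supp f)) => fy.
    rewrite (prodg_rem (x := y)) ?dsum_supp_uniq //= ?eqxx.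
      rewrite big1_seq ?mulg1 // => x /=.
      rewrite mem_rem_uniq ?dsum_supp_uniq // !inE => /andP[/negPf].
      by rewrite eq_sym => ->.
    move=> a b ab; case: (eqVneq y a) => [ya|_].
      by rewrite ya (negPf ab); apply: commute1.
    exact/commute_sym/commute1.
  rewrite big1_seq => [|x /= fx]; first exact: dsum_suppN.
  by case: eqP => // yx; rewrite yx fx in fy.
by elim/big_ind: _ => // x _; apply: Kinj.
Qed.

End DirectSumTheory.

Section SemidirectTheory.
Variables (N G : groupType) (A : aut_action G N).
Implicit Types (g h : G) (u v : N).

Lemma sd_base_morph : {morph (fun u => SDProd A u 1) : u v / u * v}.
Proof. by move=> u v; congr SDProd; rewrite /= ?act1 ?mulg1. Qed.
Definition sd_base : {gmorph N -> sdprod A} := gmorph_of sd_base_morph.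

Lemma sd_incl_morph : {morph (fun g => SDProd A 1 g) : g h / g * h}.
Proof. by move=> g h; congr SDProd; rewrite /= aut_act1 mulg1. Qed.
Definition sd_incl : {gmorph G -> sdprod A} := gmorph_of sd_incl_morph.

Lemma sd_proj_morph : {morph (fun s : sdprod A => sd_top s) : s t / s * t}.
Proof. by []. Qed.
Definition sd_proj : {gmorph sdprod A -> G} := gmorph_of sd_proj_morph.

Lemma sd_inclK : cancel sd_incl sd_proj. Proof. by []. Qed.

Lemma sd_conj g u : sd_incl g * sd_base u = sd_base (A g u) * sd_incl g.
Proof. by congr SDProd; rewrite /= ?act1 !mul1g ?mulg1. Qed.

Lemma sd_split (s : sdprod A) : s = sd_base (sd_ker s) * sd_incl (sd_top s).
Proof. by case: s => u g; congr SDProd; rewrite /= ?act1 ?mulg1 ?mul1g. Qed.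

Lemma sd_lift_exists (Q : groupType) (a : {gmorph G -> Q})
    (b : {gmorph N -> Q}) :
    (forall g u, a g * b u = b (A g u) * a g) ->
  exists h : {gmorph sdprod A -> Q}, h \o sd_incl =1 a /\ h \o sd_base =1 b.
Proof.
move=> ab; pose h (s : sdprod A) := b (sd_ker s) * a (sd_top s).
have hM : {morph h : s t / s * t}.
  move=> s t; rewrite /h /= !gmulfM -!mulgA; congr (_ * _).
  by rewrite !mulgA ab.
exists (gmorph_of hM); split=> z /=; first by rewrite /h /= gmulf1 mul1g.
by rewrite /h /= gmulf1 mulg1.
Qed.

End SemidirectTheory.

Section WreathTheory.
Variables (G W : groupType) (X : choiceType) (A : gset G X).
Local Notation wreath := (wreath W A).

Definition wreath_incl : {gmorph G -> wreath} := sd_incl (dsum_aut_action W A).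
Definition wreath_inj x : {gmorph W -> wreath} :=
  sd_base (dsum_aut_action W A) \o dsum_inj W x.

Lemma dsum_act_inj g x w :
  dsum_act A g (dsum_inj W x w) = dsum_inj W (A g x) w.
Proof.
apply: dsum_ext => y /=; congr (if _ then _ else _).
by apply/eqP/eqP => [<-|->]; rewrite -actM ?mulgV ?mulVg act1.
Qed.

Lemma wreath_inj_conj g x w :
  wreath_incl g * wreath_inj x w = wreath_inj (A g x) w * wreath_incl g.
Proof. by rewrite /wreath_inj /= sd_conj /= dsum_act_inj. Qed.

Lemma wreath_inj_conjV g x w :
  wreath_inj x w ^ (wreath_incl g)^-1 = wreath_inj (A g x) w.
Proof. by rewrite conjgE invgK mulgA wreath_inj_conj -mulgA mulgV mulg1. Qed.

Lemma wreath_inj_commute x y v w :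
  x != y -> commute (wreath_inj x v) (wreath_inj y w).
Proof.
move=> xy; exact: (gmulf_commute (sd_base (dsum_aut_action W A))
                                 (dsum_inj_commute v w xy)).
Qed.

Lemma wreath_gen (K : set wreath) : is_subgroup K ->
    (forall g, K (wreath_incl g)) -> (forall x w, K (wreath_inj x w)) ->
  forall s, K s.
Proof.
move=> sK Kincl Kinj s; rewrite [s]sd_split.
case: (sK) => _ KM _; apply: KM; last exact: Kincl.
apply: (dsum_gen (subgroup_preim (sd_base (dsum_aut_action W A)) sK)) => x w.
exact: Kinj.
Qed.

Lemma wreath_lift_exists (Q : groupType) (a : {gmorph G -> Q})
    (k : X -> {gmorph W -> Q}) :
    (forall x y v w, x != y -> commute (k x v) (k y w)) ->
    (forall g x w, a g * k x w = k (A g x) w * a g) ->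
  exists h : {gmorph wreath -> Q},
    h \o wreath_incl =1 a /\ forall x, h \o wreath_inj x =1 k x.
Proof.
move=> /dsum_lift_exists[b bE] ak.
have ab g u : a g * b u = b (dsum_act A g u) * a g.
  move: u; apply: dsum_gen => [|x w]; last by rewrite dsum_act_inj !bE.
  split=> [|u v au av|u au].
  - have -> : dsum_act A g (1 : dsum W X) = 1 by apply: dsum_ext.
    by rewrite gmulf1 mulg1 mul1g.
  - by rewrite dsum_act_morph !gmulfM mulgA au -mulgA av mulgA.
  - have -> : dsum_act A g u^-1 = (dsum_act A g u)^-1 by apply: dsum_ext.
    rewrite !gmulfV; apply: (mulgI (b (dsum_act A g u))).
    by rewrite !mulgA -au mulgK mulgV mul1g.
have [h [ha hb]] := sd_lift_exists (A := dsum_aut_action W A) ab.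
exists h; split=> // x w; rewrite -bE; exact: hb.
Qed.

End WreathTheory.

(** * A presentation of the wreath product *)

Section OrbitRepresentatives.
Variables (G : groupType) (X : choiceType) (A : gset G X).

(** The representatives are the fixed points of [r], one per orbit; later conditions [r x = x] say
    that [x] is one of them. *)
Definition orbit_reps (r : X -> X) (t : X -> G) :=
  (forall x, A (t x) (r x) = x) /\ (forall g x, r (A g x) = r x).

Lemma orbit_actE g x : Defs.orbit A (A g x) = Defs.orbit A x.
Proof.
apply/seteqP; split=> _ [h _ <-]; first by exists (h * g); rewrite ?actM.
by exists (h * g^-1); rewrite // -actM mulgVK.
Qed.

Lemma orbit_reps_exists x0 :
  exists r t, [/\ orbit_reps r t, r x0 = x0
                & finitely_many_orbits A -> finite_set (range r)].
Proof.
(* Choosing on orbits as sets makes the choice invariant, and the orbit of [x0] is forced to yield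
   [x0]. Orbits are nonempty, so the default of [xget] never occurs. *)
pose c (O : set X) := if pselect (O x0) then x0 else xget x0 O.
have cP x : exists g, A g (c (Defs.orbit A x)) = x.
  rewrite /c; case: pselect => [[g _ gx]|_] /=.
    by exists g^-1; rewrite -gx -actM mulVg act1.
  have xx : Defs.orbit A x x by exists 1; rewrite ?act1.
  have [g _ <-] := xgetI x0 xx.
  by exists g^-1; rewrite -actM mulVg act1.
have [t tP] := choice cP.
exists (c \o Defs.orbit A), t; split.
- by split=> // g x /=; rewrite orbit_actE.
- rewrite /= /c; case: pselect => // -[]; exists 1; rewrite ?act1 //.
move=> fO; apply: sub_finite_set (finite_image c fO).
by move=> _ [x _ <-]; exists (Defs.orbit A x) => //; exists x.
Qed.

Lemma orbit_repsK r t : orbit_reps r t -> forall x, r (r x) = r x.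
Proof. by move=> [tP rP] x /=; rewrite -[in RHS](tP x) rP. Qed.

End OrbitRepresentatives.

Lemma commg1P (G : groupType) (x y : G) : [~ x, y] = 1 <-> commute x y.
Proof. by split=> [/eqP/commgP|/commgP/eqP]. Qed.

Lemma commute_conj (G : groupType) (x y z : G) :
  commute x y -> commute (x ^ z) (y ^ z).
Proof. by rewrite /commute -!conjMg => ->. Qed.

Section Relations.
Variables (G V W : groupType) (X : choiceType) (A : gset G X).
Variables (r : X -> X) (t : X -> G) (a : {gmorph V -> W}).
Hypothesis rt : orbit_reps A r t.
Hypothesis a_surj : set_surj setT setT a.

(** Relators are formal data, so that one finite set of them can be evaluated in every target group.
    [Comm x v g y u] concerns the copy at [x] and the [g]-translate of the copy at [y]. *)
Inductive relation :=
  | Stab of X & G & V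
  | Comm of X & V & G & X & V
  | Ker of X & V.

Definition valid (l : relation) : Prop :=
  match l with
  | Stab x h _ => r x = x /\ A h x = x
  | Comm x _ g y _ => [/\ r x = x, r y = y & x <> A g y]
  | Ker x v => r x = x /\ a v = 1
  end.

Section Relator.
Variables (Q : groupType) (i : {gmorph G -> Q}) (j : X -> {gmorph V -> Q}).

(** The exponent [(i g)^-1] turns right conjugation into the left action: the conjugate plays the
    role of the copy at [A g y]. *)
Definition relator (l : relation) : Q :=
  match l with
  | Stab x h v => [~ i h, j x v]
  | Comm x v g y u => [~ j x v, j y u ^ (i g)^-1]
  | Ker x v => j x v
  end.

(** Since [h^-1 * g] fixes [x], it commutes with the copy at [x]; so a conjugate copy depends only
    on the point it sits over. *)
Lemma stab_conj_eq :
    (forall x h v, valid (Stab x h v) -> relator (Stab x h v) = 1) ->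
  forall x g h v, r x = x -> A g x = A h x ->
  j x v ^ (i g)^-1 = j x v ^ (i h)^-1.
Proof.
move=> relS x g h v rx gh.
have -> : g = h * (h^-1 * g) by rewrite mulgA mulgV mul1g.
rewrite gmulfM invgM conjgM; congr conjg; rewrite -gmulfV.
apply/conjg_fixP/eqP/commg1P; rewrite gmulfV; apply: commuteV.
apply/commute_sym/commg1P; apply: (relS x); split=> //.
by rewrite actM gh -actM mulVg act1.
Qed.

(** Over each [x], [k x] is the copy at [r x] conjugated by [t x]. The [Ker] relators make it factor
    through [a], the [Comm] relators make distinct copies commute, and the [Stab] relators give
    equivariance. *)
Lemma wreath_presented : (forall l, valid l -> relator l = 1) ->
  exists h : {gmorph wreath W A -> Q}, h \o wreath_incl W A =1 i /\
    forall x v, r x = x -> h (wreath_inj W A x (a v)) = j x v.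
Proof.
move=> rel1; have [tP rP] := rt; have rK := orbit_repsK rt.
have conj_eq := stab_conj_eq (fun x h v => rel1 (Stab x h v)).
have /choice[k kE] x : exists k : {gmorph W -> Q},
    forall v, k (a v) = j (r x) v ^ (i (t x))^-1.
  have cM : {morph (fun v => j (r x) v ^ (i (t x))^-1) : u v / u * v}.
    by move=> u v; rewrite gmulfM conjMg.
  apply: (gmorph_factor (f := gmorph_of cM) a_surj) => v av /=.
  have -> : j (r x) v = 1; last exact: conj1g.
  by apply: (rel1 (Ker (r x) v)); split=> //; apply: rK.
have a_onto w : exists v, a v = w by case: (@a_surj w I) => v _ <-; exists v.
have kC x y v w : x != y -> commute (k x v) (k y w).
  move=> /eqP xy; have [{}v <-] := a_onto v; have [{}w <-] := a_onto w.
  (* Up to conjugation by [t x], this is the relator for [r x] and the translate of [r y] by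
     [(t x)^-1 * t y]. *)
  rewrite !kE (_ : t y = t x * ((t x)^-1 * t y)); last first.
    by rewrite mulgA mulgV mul1g.
  rewrite gmulfM invgM conjgM; apply/commute_conj/commg1P.
  apply: (rel1 (Comm (r x) v ((t x)^-1 * t y) (r y) w)).
  split; try exact: rK.
  by rewrite actM tP => rxE; apply: xy; rewrite -(tP x) rxE -actM mulgV act1.
have kJ g x w : i g * k x w = k (A g x) w * i g.
  have [v <-] := a_onto w; rewrite !kE conjgCV rP; congr (_ * _).
  rewrite -conjgM -invgM -gmulfM; apply: conj_eq; first exact: rK.
  by rewrite actM tP -[r x](rP g) tP.
have [h [hi hk]] := wreath_lift_exists kC kJ.
exists h; split=> // x v rx; have /= -> := hk x (a v).
rewrite kE rx; have := conj_eq x (t x) 1 v rx; rewrite act1 => -> //.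
  by rewrite gmulf1 invg1 conjg1.
by rewrite -{2}rx tP.
Qed.

End Relator.

Lemma relator_morph (Q Q' : groupType) (i : {gmorph G -> Q})
    (j : X -> {gmorph V -> Q}) (f : {gmorph Q -> Q'})
    (i' : {gmorph G -> Q'}) (j' : X -> {gmorph V -> Q'}) l :
  valid l -> f \o i =1 i' -> (forall x, r x = x -> f \o j x =1 j' x) ->
  f (relator i j l) = relator i' j' l.
Proof.
move=> + fi fj; have fiE g : f (i g) = i' g by apply: fi.
have fjE x v : r x = x -> f (j x v) = j' x v by move=> rx; apply: (fj x rx v).
case: l => [x h v [rx _]|x v g y u [rx ry _]|x v [rx _]] /=.
- by rewrite gmulfR fiE fjE.
- by rewrite gmulfR gmulfJ gmulfV fiE !fjE.
exact: fjE.
Qed.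

Definition wreath_inj_comp x : {gmorph V -> wreath W A} :=
  wreath_inj W A x \o a.

Lemma wreath_relator l : valid l ->
  relator (wreath_incl W A) wreath_inj_comp l = 1.
Proof.
case: l => [x h v [rx hx]|x v g y u [rx ry xy]|x v [rx av]].
- by apply/commg1P; rewrite /commute /= wreath_inj_conj hx.
- apply/commg1P; rewrite /wreath_inj_comp [X in _ ^ X]/= /= wreath_inj_conjV.
  by apply: wreath_inj_commute; apply/eqP.
by rewrite -[LHS]/(wreath_inj W A x (a v)) av gmulf1.
Qed.

Section Presentation.
Hypotheses (r_finite : finite_set (range r)).
Hypotheses (G_fp : finitely_presented G) (V_fp : finitely_presented V).

(** [P] is the free product of [G] with a copy of [V] per representative. The relators give the
    whole kernel: by [wreath_presented], the quotient map of [P] by them factors through [q]. *)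
Lemma wreath_cover : exists (P : groupType) (i : {gmorph G -> P})
    (j : X -> {gmorph V -> P}) (q : {gmorph P -> wreath W A}),
  [/\ finitely_presented P, set_surj setT setT q,
      forall x, q x = 1 <-> normal_closure (relator i j @` valid) x,
      q \o i =1 wreath_incl W A /\
        (forall x, r x = x -> q \o j x =1 wreath_inj_comp x)
    & forall (Q : groupType) (i' : {gmorph G -> Q}) (j' : X -> {gmorph V -> Q}),
        exists f : {gmorph P -> Q}, f \o i =1 i' /\
          forall x, r x = x -> f \o j x =1 j' x].
Proof.
have [tP rP] := rt; have rK := orbit_repsK rt.
have /finite_seqP[s sE] := r_finite.
have mem_s x : (x \in undup s) <-> r x = x.
  rewrite mem_undup; split=> [xs|rx].
    have : range r x by rewrite sE.
    by move=> [y _ <-]; apply: rK.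
  have : range r x by exists x.
  by rewrite sE.
have [P [i [j [P_fp genP uniP]]]] := coproduct_family_exists
  (undup_uniq s) G_fp V_fp.
have {}uniP (Q : groupType) (i' : {gmorph G -> Q}) (j' : X -> {gmorph V -> Q}) :
    exists f : {gmorph P -> Q}, f \o i =1 i' /\
      forall x, r x = x -> f \o j x =1 j' x.
  have [f [fi fj]] := uniP Q i' j'; exists f; split=> // x /mem_s.
  exact: fj.
have [q [qi qj]] := uniP _ (wreath_incl W A) wreath_inj_comp.
have q_rel l : valid l -> q (relator i j l) = 1.
  by move=> vl; rewrite (relator_morph vl qi qj) wreath_relator.
exists P, i, j, q; split=> //.
  have q_sub : is_subgroup [set w | exists x, q x = w].
    split=> [|_ _ [x <-] [y <-]|_ [x <-]].
    - by exists 1; rewrite gmulf1.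
    - by exists (x * y); rewrite gmulfM.
    - by exists x^-1; rewrite gmulfV.
  suff q_all : forall w, [set w | exists x, q x = w] w.
    by move=> w _; have [x <-] := q_all w; exists x.
  apply: wreath_gen => // [g|x w]; first by exists (i g); apply: qi.
  case: (@a_surj w I) => v _ <-.
  exists (j (r x) v ^ (i (t x))^-1).
  have qjv : q (j (r x) v) = wreath_inj W A (r x) (a v) by apply: qj; apply: rK.
  have qit : q (i (t x)) = wreath_incl W A (t x) by apply: qi.
  by rewrite gmulfJ gmulfV qjv qit wreath_inj_conjV tP.
have [Q [f [_ fN]]] := quotient_exists (normal_closureP (relator i j @` valid)).
have [l vl|h [hi hj]] := @wreath_presented Q (f \o i) (fun x => f \o j x).
  rewrite -(@relator_morph _ _ i j f) //; apply/fN; apply: mem_normal_closure.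
  by exists l.
have hq x : h (q x) = f x.
  apply: (genP _ (eq_gmorph_subgroup (h \o q) f)) => [g|y v /mem_s ry] /=.
    by have /= -> := qi g; apply: hi.
  by have /= -> := qj _ ry v; apply: hj.
move=> x; split=> [qx|]; first by apply/fN; rewrite -hq qx gmulf1.
apply: (smallest_sub (normal_ker q)) => _ [l vl <-]; exact: q_rel.
Qed.

(** The kernel of the cover is the normal closure of a finite set, whose elements involve only
    finitely many relators by [normal_closure_compact]. *)
Lemma wreath_fp_finite_relations : finitely_presented (wreath W A) ->
  exists2 D : set relation, finite_set D & D `<=` valid /\
    forall (Q : groupType) (i : {gmorph G -> Q}) (j : X -> {gmorph V -> Q}),
      (forall l, D l -> relator i j l = 1) ->
    exists h : {gmorph wreath W A -> Q}, h \o wreath_incl W A =1 i /\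
      forall x v, r x = x -> h (wreath_inj W A x (a v)) = j x v.
Proof.
move=> wr_fp.
have [P [i [j [q [P_fp q_surj qN [qi qj] uniP]]]]] := wreath_cover.
have [S fS qS] :=
  finitely_presented_ker (finitely_presented_fg P_fp) wr_fp q_surj.
have [|D fD [Dvalid SD]] :=
  @normal_closure_compact _ (relator i j @` valid) S fS.
  by move=> x Sx; apply/qN/qS; apply: mem_normal_closure.
(* The [option] supplies a default value, as [relation] is empty when [X] is. *)
have /choice[c cP] d : exists l : option relation, D d ->
    exists2 l', l = Some l' & valid l' /\ relator i j l' = d.
  case: (pselect (D d)) => [/Dvalid[l vl lE]|nD]; last by exists None.
  by exists (Some l) => _; exists l.
exists (Some @^-1` (c @` D)).
  apply: finite_preimage; last exact: finite_image.
  by move=> ? ? _ _ [].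
split=> [l [d /cP[l' -> [vl' _]] [<-]] //|Q i' j' D1].
have [f [fi fj]] := uniP Q i' j'.
have fD1 x : normal_closure D x -> f x = 1.
  apply: (smallest_sub (normal_ker f)) => d Dd; have [l cl [vl lE]] := cP d Dd.
  rewrite /preimage /= -lE (relator_morph vl fi fj); apply: D1.
  by exists d.
have [|h hE] := gmorph_factor (f := f) q_surj.
  move=> x /qS; apply: (smallest_sub (normal_ker f)) => s /SD; exact: fD1.
exists h; split=> [g|x v rx].
  exact: etrans (congr1 h (esym (qi g))) (etrans (hE _) (fi g)).
exact: etrans (congr1 h (esym (qj x rx v))) (etrans (hE _) (fj x rx v)).
Qed.

(** The hypothesis is applied in the quotient of [P] by the relators from [D], where it makes all
    valid relators trivial. *)
Lemma wreath_fp_intro (D : set relation) : finite_set D -> D `<=` valid ->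
    (forall (Q : groupType) (i : {gmorph G -> Q}) (j : X -> {gmorph V -> Q}),
      (forall l, D l -> relator i j l = 1) ->
      forall l, valid l -> relator i j l = 1) ->
  finitely_presented (wreath W A).
Proof.
move=> fD Dvalid Dall.
have [P [i [j [q [P_fp q_surj qN _ uniP]]]]] := wreath_cover.
apply: (finitely_presented_quotient (S := relator i j @` D) P_fp q_surj)
  => [|x].
  exact: finite_image.
rewrite qN; split; last by apply: normal_closureS; apply: image_subset.
have [Q [f [_ fN]]] := quotient_exists (normal_closureP (relator i j @` D)).
move=> Nx; apply/fN; move: x Nx.
apply: (smallest_sub (normal_ker f)) => _ [l vl <-].
rewrite /preimage /= (@relator_morph _ _ i j f (f \o i) (fun x => f \o j x)) //.
apply: Dall => // k Dk.
rewrite -(@relator_morph _ _ i j f) //; last exact: Dvalid.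
by apply/fN; apply: mem_normal_closure; exists k.
Qed.

End Presentation.
End Relations.

Lemma diag_orbits_finite (G : groupType) (X : Type) (A : gset G X) :
  finitely_many_orbits (diag_gset A) -> finitely_many_orbits A.
Proof.
move=> fO; apply: sub_finite_set (finite_image (fun O => fst @` O) fO).
move=> _ [x _ <-]; exists (Defs.orbit (diag_gset A) (x, x)).
  by exists (x, x).
apply/seteqP; split=> [_ [_ [g _ <-] <-]|_ [g _ <-]]; first by exists g.
by exists (A g x, A g x) => //; exists g.
Qed.

Lemma commute_gen (G H Q : groupType) (f : {gmorph G -> Q})
    (g : {gmorph H -> Q}) (S : set G) (T : set H) :
    (forall x y, S x -> T y -> commute (f x) (g y)) ->
  forall x y, generated_subgroup S x -> generated_subgroup T y ->
  commute (f x) (g y).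
Proof.
move=> ST x y Sx Ty; move: x Sx.
apply: (smallest_sub (commute_subgroup f (g y))) => x Sx.
apply/commute_sym; move: y Ty.
apply: (smallest_sub (commute_subgroup g (f x))) => y Ty.
exact/commute_sym/ST.
Qed.

Lemma gmorph_conj_morph (G Q : groupType) (f : {gmorph G -> Q}) (z : Q) :
  {morph (fun x => f x ^ z) : x y / x * y}.
Proof. by move=> x y; rewrite gmulfM conjMg. Qed.

Definition gmorph_conj (G Q : groupType) (f : {gmorph G -> Q}) (z : Q) :
  {gmorph G -> Q} := gmorph_of (gmorph_conj_morph f z).

(** * Sufficiency *)

Section Sufficiency.
Variables (G W : groupType) (X : choiceType) (A : gset G X).

(** Here [V] is [W] and [a] the identity. [D1] uses generators of the stabilizers and of [W]; [D2]
    uses one pair from each off-diagonal orbit of the square and generators of [W]. *)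
Lemma wreath_fp (x0 : X) :
    finitely_presented W -> finitely_presented G ->
    (forall x, finitely_generated (stabilizer A x)) ->
    finitely_many_orbits (diag_gset A) ->
  finitely_presented (wreath W A).
Proof.
move=> W_fp G_fp stab_fg fO.
have [r [t [rt _ /(_ (diag_orbits_finite fO)) r_finite]]] :=
  orbit_reps_exists A x0.
have [r2 [t2 [[t2P r2P] _ /(_ fO) r2_finite]]] :=
  orbit_reps_exists (diag_gset A) (x0, x0).
have r2K := orbit_repsK (conj t2P r2P).
have [tP rP] := rt; have rK := orbit_repsK rt.
have id_surj : set_surj setT setT (gmorph_id W) by move=> w _; exists w.
have [S fS WS] := finitely_presented_fg W_fp.
have genS w : generated_subgroup S w by rewrite -WS.
have /choice[H HP] x :
    exists H, finite_set H /\ stabilizer A x = generated_subgroup H.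
  by have [H fH xH] := stab_fg x; exists H.
have genH x h : A h x = x -> generated_subgroup (H x) h.
  by case: (HP x) => _ <-.
pose D1 : set (relation G W X) :=
  \bigcup_(x in range r) [set Stab x p.1 p.2 | p in H x `*` S].
pose D2 : set (relation G W X) :=
  \bigcup_(p in range r2 `&` [set p | p.1 <> p.2])
    [set Comm (r p.1) q.1 ((t p.1)^-1 * t p.2) (r p.2) q.2 | q in S `*` S].
apply: (@wreath_fp_intro _ _ _ _ A r t (gmorph_id W) rt id_surj r_finite G_fp
  W_fp (D1 `|` D2)).
- rewrite finite_setU; split; apply: bigcup_finite => //.
  + by move=> x _; apply/finite_image/finite_setX => //; case: (HP x).
  + exact: finite_setIl.
  + by move=> p _; apply/finite_image/finite_setX.
- move=> _ [[_ [y _ <-] [[h v] [/= Hh _] <-]]|[[x y] [_ /= xy] [[v u] _ <-]]].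
  + split; first exact: rK.
    have : generated_subgroup (H (r y)) h by apply: mem_generated_subgroup.
    by case: (HP (r y)) => _ <-.
  + split; try exact: rK.
    rewrite actM tP => rxE; apply: xy.
    by rewrite -(tP x) rxE -actM mulgV act1.
move=> Q i j D0.
have relS x h v : valid A r (gmorph_id W) (Stab x h v) ->
    relator i j (Stab x h v) = 1.
  move=> [rx hx]; apply/commg1P.
  apply: commute_gen (genH x h hx) (genS v) => {hx}h {}v Hh Sv.
  apply/commg1P; apply: (D0 (Stab x h v)); left; exists x; first by exists x.
  by exists (h, v).
have conj_eq := stab_conj_eq relS.
case=> [x h v|x v g y u [rx ry xy]|x v [_ /= ->]]; first exact: relS.
- apply/commg1P; apply: (commute_gen (g := gmorph_conj (j y) (i g)^-1) _
    (genS v) (genS u)) => {}v {}u Sv Su /=.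
  (* The relator of the representative pair [(b, c)] is conjugated by [k * t b]. This sends [x] to
     itself, and [k * t c] agrees with [g] on [y], so [stab_conj_eq] gives the desired
     commutator. *)
  pose p := (x, A g y); pose k := t2 p; case abE : (r2 p) => [b c].
  have := t2P p; rewrite abE => -[kb kc].
  have rb : r b = x by rewrite -rx -kb rP.
  have rc : r c = y by rewrite -ry -(rP g y) -kc rP.
  have bc : b <> c by move=> bc; apply: xy; rewrite -kb -kc bc.
  have /commg1P/(commute_conj (i (k * t b))^-1) :
      relator i j (Comm (r b) v ((t b)^-1 * t c) (r c) u) = 1.
    apply: D0; right; exists (b, c).
      by split=> //; exists p.
    by exists (v, u).
  rewrite -conjgM -invgM -gmulfM rb rc mulgA mulgK.
  rewrite (conj_eq x (k * t b) 1) // ?gmulf1 ?invg1 ?conjg1; last first.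
    by rewrite act1 actM -[in LHS]rb tP.
  rewrite (conj_eq y _ g) //.
  by rewrite actM -[in LHS]rc tP.
by rewrite /= gmulf1.
Qed.

End Sufficiency.

(** * Necessity *)

Section Translation.
Variable G : groupType.

Definition translate (g : G) (S : set G) : set G := [set x | S (g^-1 * x)].

Lemma translate1 S : translate 1 S = S.
Proof. by apply/seteqP; split=> x; rewrite /translate /= invg1 mul1g. Qed.

Lemma translateM g h S : translate (g * h) S = translate g (translate h S).
Proof. by apply/seteqP; split=> x; rewrite /translate /= invgM mulgA. Qed.

(** The orbit of a subgroup [L] here is its space of left cosets, with stabilizer [L] at the point
    [L]; this avoids building coset spaces. *)
Definition translation_gset : gset G (set G) := GSet translate1 translateM.

Definition regular_gset : gset G G :=
  GSet (@mul1g G) (fun g h x => esym (mulgA g h x)).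

End Translation.

Section FunctionGroup.
Variables (Z : Type) (P : groupType).

(** There is no support condition: in [wreath_diag_orbits_finite] one element acts on the
    coordinates [(x, y)] for all [y] at once. *)
Definition fun_group : Type := Z -> P.

HB.instance Definition _ := gen_eqMixin fun_group.
HB.instance Definition _ := gen_choiceMixin fun_group.

Implicit Types f : fun_group.

Definition fun_group_one : fun_group := fun=> 1.
Definition fun_group_mul f f' : fun_group := fun z => f z * f' z.
Definition fun_group_inv f : fun_group := fun z => (f z)^-1.

Lemma fun_group_mulA : associative fun_group_mul.
Proof. by move=> f1 f2 f3; apply/funext => z; apply: mulgA. Qed.
Lemma fun_group_mul1 : left_id fun_group_one fun_group_mul.
Proof. by move=> f; apply/funext => z; apply: mul1g. Qed.
Lemma fun_group_mulr1 : right_id fun_group_one fun_group_mul.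
Proof. by move=> f; apply/funext => z; apply: mulg1. Qed.
Lemma fun_group_mulV : left_inverse fun_group_one fun_group_inv fun_group_mul.
Proof. by move=> f; apply/funext => z; apply: mulVg. Qed.
Lemma fun_group_mulrV : right_inverse fun_group_one fun_group_inv fun_group_mul.
Proof. by move=> f; apply/funext => z; apply: mulgV. Qed.

HB.instance Definition _ := isGroup.Build fun_group
  fun_group_mulA fun_group_mul1 fun_group_mulr1 fun_group_mulV fun_group_mulrV.

Variables (G : groupType) (B : gset G Z).

Definition fun_act (g : G) f : fun_group := fun z => f (B g^-1 z).

Lemma fun_act1 f : fun_act 1 f = f.
Proof. by apply/funext => z; rewrite /fun_act invg1 act1. Qed.
Lemma fun_actM k l f : fun_act (k * l) f = fun_act k (fun_act l f).
Proof. by apply/funext => z; rewrite /fun_act invgM actM. Qed.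
Lemma fun_act_morph g : {morph fun_act g : f1 f2 / f1 * f2}.
Proof. by []. Qed.

Definition fun_aut_action : aut_action G fun_group :=
  @AutAction _ _ (GSet fun_act1 fun_actM) fun_act_morph.

End FunctionGroup.

(** * Finite generation of the base group and finiteness of the orbit set *)

Section Necessity.
Variables (G W : groupType) (X : choiceType) (A : gset G X).
Local Notation base s := (sd_ker (s : wreath W A) : dsum W X).

Lemma wreath_top_fp : finitely_presented (wreath W A) -> finitely_presented G.
Proof.
move=> wr_fp.
exact: finitely_presented_retract wr_fp (@sd_inclK _ _ (dsum_aut_action W A)).
Qed.

(** The group operations only multiply, invert and permute coordinates, so all coordinates lie in
    the subgroup generated by the finitely many coordinate values of the generators. *)
Lemma wreath_base_fg (x0 : X) :
  finitely_generated [set: wreath W A] -> finitely_generated [set: W].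
Proof.
move=> [Y fY genY]; pose S := \bigcup_(s in Y) range (base s).
exists S.
  apply: bigcup_finite => // s _.
  have fs : finite_set (1 |` base s @` gsupport (base s)).
    rewrite finite_setU; split; first exact: finite_set1.
    exact/finite_image/dsumP.
  apply: sub_finite_set fs => _ [x _ <-].
  by case: (pselect (base s x = 1)) => [->|sx]; [left|right; exists x].
have [S1 SM SV] := generated_subgroupP S.
apply/seteqP; split=> // w _.
have wY : generated_subgroup Y (wreath_inj W A x0 w) by rewrite -genY.
pose K : set (wreath W A) :=
  [set s | forall x, generated_subgroup S (base s x)].
have sK : is_subgroup K.
  split=> [x|s s' sP s'P x|s sP x]; first exact: S1.
    by apply: SM; [apply: sP|apply: s'P].
  by apply: SV; apply: sP.
have YK : Y `<=` K.
  move=> s Ys x; apply: mem_generated_subgroup.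
  by exists s => //; exists x.
by have := smallest_sub sK YK wY x0; rewrite /= eqxx.
Qed.

(** Supports move only within orbits, so they stay in the orbits met by supports of generators; as
    [W] is nontrivial, every point is the support of some element. *)
Lemma wreath_orbits_finite : (exists w : W, w <> 1) ->
  finitely_generated [set: wreath W A] -> finitely_many_orbits A.
Proof.
move=> [w w1] [Y fY genY]; pose O := \bigcup_(s in Y) gsupport (base s).
have fO : finite_set O by apply: bigcup_finite => // s _; apply: dsumP.
apply: sub_finite_set (finite_image (Defs.orbit A) fO) => _ [x _ <-].
have wY : generated_subgroup Y (wreath_inj W A x w) by rewrite -genY.
pose K : set (wreath W A) :=
  [set s | forall y, base s y <> 1 -> (Defs.orbit A @` O) (Defs.orbit A y)].
have sK : is_subgroup K.
  split=> [//|s s' sP s'P y|s sP y] /= sy.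
    case: (pselect (base s y = 1)) => [sy1|]; last exact: sP.
    rewrite -(orbit_actE A (sd_top s)^-1); apply: s'P => s'y.
    by apply: sy; rewrite sy1 s'y mulg1.
  rewrite -(orbit_actE A (sd_top s)^-1^-1); apply: sP => sy1.
  by apply: sy; rewrite sy1 invg1.
have YK : Y `<=` K by move=> s Ys y sy; exists y => //; exists s.
by apply: (smallest_sub sK YK wY); rewrite /= eqxx.
Qed.

(** * Consequences of a finite set of defining relators *)

Section Finite.
Variables (x0 : X) (r : X -> X) (t : X -> G) (n : nat).
Variable a : {gmorph free_group 'I_n -> W}.
Local Notation V := (free_group 'I_n).
Hypotheses (rt : orbit_reps A r t) (r_finite : finite_set (range r)).
Hypotheses (rx0 : r x0 = x0) (a_surj : set_surj setT setT a).
Hypothesis W_nontrivial : exists w : W, w <> 1.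
Variable D : set (relation G V X).
Hypotheses (D_finite : finite_set D) (D_valid : D `<=` valid A r a).
Hypothesis D_presents :
  forall (Q : groupType) (i : {gmorph G -> Q}) (j : X -> {gmorph V -> Q}),
      (forall l, D l -> relator i j l = 1) ->
    exists h : {gmorph wreath W A -> Q}, h \o wreath_incl W A =1 i /\
      forall x v, r x = x -> h (wreath_inj W A x (a v)) = j x v.

(** The relators of [D] hold in the wreath product over the quotient of [V] by [R]. If [a v = 1],
    the induced map sends 1 to the copy of [p v] at [x0], so [p v = 1]. *)
Lemma wreath_base_fp : finitely_presented W.
Proof.
pose R := [set if l is Ker _ v then v else 1 | l in D].
apply/finitely_presentedP; exists n, R, a; split=> [|//|v].
  exact: finite_image.
split; last first.
  apply: (smallest_sub (normal_ker a)) => _ [l Dl <-].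
  case: l Dl => [? ? ?|? ? ? ? ?|x u] Dl; rewrite /preimage /= ?gmulf1 //.
  by case: (D_valid Dl).
have [Q [p [_ pR]]] := quotient_exists (normal_closureP R).
have [l Dl|h [_ hj]] :=
  @D_presents (wreath Q A) (wreath_incl Q A) (wreath_inj_comp A p).
  apply: (@wreath_relator _ _ _ _ A r); move: (D_valid Dl).
  case: l Dl => //= x u Dl [rx _]; split=> //.
  by apply/pR; apply: mem_normal_closure; exists (Ker G x u).
move=> av; apply/pR; have := hj x0 v rx0; rewrite av !gmulf1.
move=> /(congr1 (fun s : wreath Q A => (sd_ker s : dsum Q X) x0)) /=.
by rewrite eqxx.
Qed.

(** Only the copy over [x0] is kept, placed at the point [L] of the set of subsets of [G]; an
    element fixing [x0] must then fix [L], that is, lie in [L]. *)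
Lemma wreath_stabilizer_fg : finitely_generated (stabilizer A x0).
Proof.
pose S :=
  [set if l is Stab x h _ then if x == x0 then h else 1 else 1 | l in D].
exists S; first exact: finite_image.
have SL : S `<=` stabilizer A x0.
  move=> _ [l /D_valid vl <-]; case: l vl => [x h v [_ hx]|x v g y u _|x v _].
  - by case: eqP => [<-//|_]; apply: act1.
  - exact: act1.
  - exact: act1.
have sL : is_subgroup (stabilizer A x0).
  split=> [|g h gx hx|g gx]; rewrite /stabilizer /= ?act1 ?actM ?hx //.
  by rewrite -[in LHS]gx -actM mulVg act1.
pose L := generated_subgroup S; have [L1 LM LV] := generated_subgroupP S.
apply/seteqP; split; last exact: smallest_sub.
have LP g : translate g L = L <-> L g.
  split=> [gL|Lg].
    have : translate g L 1 by rewrite gL.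
    by rewrite /translate /= mulg1 => /LV; rewrite invgK.
  apply/seteqP; split=> z Lz; last by apply: LM => //; apply: LV.
  by rewrite -(mulVKg g z); apply: LM.
have one_morph :
  {morph (fun=> 1) : u v / u * v : V >-> u * v : wreath W (translation_gset G)}.
  by move=> u v; rewrite mulg1.
pose j x : {gmorph V -> wreath W (translation_gset G)} :=
  if x == x0 then wreath_inj_comp (translation_gset G) a L
  else gmorph_of one_morph.
have [l Dl|h [hi hj]] := @D_presents _ (wreath_incl W (translation_gset G)) j.
  have := D_valid Dl; case: l Dl => [x g v|x v g y u|x v] Dl /=
    => [[rx gx]|[rx ry xy]|[rx av]].
  - apply/commg1P; rewrite /j; case: eqP => xx0; last exact: commute1.
    rewrite /commute /wreath_inj_comp /= wreath_inj_conj.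
    congr (wreath_inj _ _ _ _ * _); apply/LP; apply: mem_generated_subgroup.
    by exists (Stab x g v) => //; rewrite xx0 eqxx.
  - apply/commg1P; rewrite /j; case: (x =P x0) => xx0; last first.
      exact/commute_sym/commute1.
    case: (y =P x0) => yx0; last by rewrite conj1g; apply: commute1.
    rewrite /wreath_inj_comp [X in _ ^ X]/= /= wreath_inj_conjV.
    (* If [g] fixed [L], it would lie in [L] and so fix [x0], against the validity of this
       relator. *)
    apply: wreath_inj_commute; apply/eqP => LgL; apply: xy.
    have gx0 : stabilizer A x0 g.
      by apply: (smallest_sub sL SL); apply/LP/esym.
    by rewrite xx0 yx0.
  - rewrite /j; case: eqP => // _.
    by rewrite -[LHS]/(wreath_inj _ _ L (a v)) av gmulf1.
have [w w1] := W_nontrivial; have [v _ vw] := @a_surj w I.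
move=> g gx0; apply/LP.
have jL : h (wreath_inj W A x0 w) = wreath_inj W (translation_gset G) L w.
  by rewrite -vw hj // /j eqxx.
have := wreath_inj_conj A g x0 w; rewrite gx0.
move=> /(congr1 h); rewrite !gmulfM jL.
have -> : h (wreath_incl W A g) = wreath_incl W (translation_gset G) g.
  exact: hi.
rewrite wreath_inj_conj => /mulIg.
(* The copies of [w] at [translate g L] and at [L] coincide; as [w] is not 1, so do the two
   points. *)
move=> /(congr1 (fun s : wreath W _ => (sd_ker s : dsum W _) L)) /=.
by rewrite eqxx; case: eqP => // _ /esym.
Qed.

(** If an off-diagonal [(x, y)] avoided the orbits of pairs from [D], up to swapping, the copies at
    [x] and [y] would have images that fail to commute at the coordinate [(x, y)], although [D]
    holds. *)
Lemma wreath_diag_orbits_finite : finitely_many_orbits (diag_gset A).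
Proof.
have [tP rP] := rt.
pose ends (l : relation G V X) :=
  if l is Comm x _ g y _ then (x, A g y) else (x0, x0).
pose swap (p : X * X) := (p.2, p.1).
pose B := diag_gset A.
(* Swapped pairs are included because a commutator of the copies at [z1] and [z2] involves the
   coordinates [(z1, z2)] and [(z2, z1)] alike. *)
pose E p := exists k, (ends @` D) (B k p) \/ (ends @` D) (B k (swap p)).
have BK k g p : B (k * g^-1) (B g p) = B k p by rewrite -actM mulgVK.
have E_act g p : E (B g p) <-> E p.
  split=> -[k kP]; first by exists (k * g); rewrite !actM.
  by exists (k * g^-1); rewrite -[swap (B g p)]/(B g (swap p)) !BK.
(* The diagonal contributes one orbit for each of the finitely many representatives. *)
suff offdiag x y : x <> y -> E (x, y).
  have fE : finite_set (ends @` D `|` swap @` (ends @` D) `|`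
                        (fun x => (x, x)) @` range r).
    by rewrite !finite_setU; do !split; apply: finite_image => //;
       apply: finite_image.
  apply: sub_finite_set (finite_image (Defs.orbit B) fE) => _ [[x y] _ <-].
  case: (pselect (x = y)) => [<-|/offdiag[k [kE|kE]]].
  - exists (r x, r x); first by right; exists (r x) => //; exists x.
    by rewrite -[in RHS](tP x) -(orbit_actE B (t x)).
  - exists (B k (x, y)); first by left; left.
    exact: orbit_actE.
  - exists (B k (x, y)); last exact: orbit_actE.
    by left; right; exists (B k (swap (x, y))).
move=> xy; apply: contrapT => nE.
pose P := wreath W (regular_gset W).
pose F := fun_group (X * X) P.
(* For [w <> 1], [e1 w] and [e2 w] do not commute, since [e2 w] moves the point 1, where [e1 w] is
   supported, to [w]. *)
pose e1 := wreath_inj W (regular_gset W) 1.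
pose e2 := wreath_incl W (regular_gset W).
pose f x (w : W) : F := fun p =>
  if pselect (E p \/ p.1 = p.2) then 1 else
  if p.1 == x then e1 w else if p.2 == x then e2 w else 1.
have fM z : {morph f z : u v / u * v}.
  move=> u v; apply/funext => p; rewrite -[RHS]/(f z u p * f z v p) /f.
  case: pselect => _ /=; first by rewrite mulg1.
  case: ifP => _; first exact: (@gmulfM _ _ e1).
  by case: ifP => _; [apply: (@gmulfM _ _ e2)|rewrite mulg1].
(* Away from [(z1, z2)] and [(z2, z1)] at most one of the functions is nontrivial, and at these two
   pairs both are 1 because the pairs lie in [E]. *)
have f_commute z1 z2 u v : z1 <> z2 -> E (z1, z2) ->
    commute (f z1 u) (f z2 v).
  move=> z12 Ez; apply/funext => p.
  rewrite -[LHS]/(f z1 u p * f z2 v p) -[RHS]/(f z2 v p * f z1 u p).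
  rewrite /f; case: pselect => // nEp /=.
  have : ~ (p = (z1, z2) \/ p = (z2, z1)).
    case=> pE; apply: nEp; left; rewrite pE //.
    by case: Ez => k kP; exists k; case: kP; [right|left].
  case: p {nEp} => p1 p2 /= np.
  case: (p1 =P z1) => [p1z1|_].
    case: (p1 =P z2) => [p1z2|_]; first by case: z12; rewrite -p1z1.
    case: (p2 =P z2) => [p2z2|_]; last by rewrite mulg1 mul1g.
    by case: np; left; rewrite p1z1 p2z2.
  case: (p2 =P z1) => [p2z1|_]; last by rewrite mulg1 mul1g.
  case: (p1 =P z2) => [p1z2|_]; first by case: np; right; rewrite p1z2 p2z1.
  case: (p2 =P z2) => [p2z2|_]; last by rewrite mulg1 mul1g.
  by case: z12; rewrite -p2z1.
pose C : aut_action G F := fun_aut_action P B.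
have f_act g z w : C g (f z w) = f (A g z) w.
  apply/funext => p; rewrite -[LHS]/(f z w (B g^-1 p)) /f.
  have Aeq q : (A g^-1 q == z) = (q == A g z).
    by apply/eqP/eqP => [<-|->]; rewrite -actM ?mulgV ?mulVg act1.
  rewrite /= !Aeq; case: pselect => Ep; case: pselect => nEp //=; exfalso.
    apply: nEp; case: Ep => [/E_act|]; first by left.
    by move=> /(congr1 (A g)); rewrite -!actM !mulgV !act1; right.
  apply: Ep; case: nEp => [Ep|->]; last by right.
  by left; apply/E_act.
pose j z : {gmorph V -> sdprod C} := sd_base C \o (gmorph_of (fM z) \o a).
have j_conj g z v : sd_incl C g * j z v = j (A g z) v * sd_incl C g.
  apply: etrans (sd_conj C g (f z (a v))) _.
  exact: (congr1 (fun u => sd_base C u * sd_incl C g) (f_act g z (a v))).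
have j_conjV g z v : j z v ^ (sd_incl C g)^-1 = j (A g z) v.
  by rewrite conjgE invgK mulgA j_conj -mulgA mulgV mulg1.
have [l Dl|h [hi hj]] := @D_presents _ (sd_incl C) j.
  have := D_valid Dl; case: l Dl => [z k v|z1 v g z2 u|z v] Dl [].
  - by move=> rz kz; apply/commg1P; rewrite /commute j_conj kz.
  - move=> rz1 rz2 z12; apply/commg1P; rewrite [X in commute _ X]j_conjV.
    apply: (gmulf_commute (sd_base C)); apply: f_commute => //.
    exists 1; left; rewrite act1.
    by exists (Comm z1 v g z2 u).
  - move=> rz av; rewrite -[LHS]/(sd_base C (gmorph_of (fM z) (a v))).
    by rewrite av !gmulf1.
have h_inj z w : h (wreath_inj W A z w) = sd_base C (f z w).
  have [v _ <-] := @a_surj w I.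
  rewrite -[z in LHS]tP -wreath_inj_conjV gmulfJ gmulfV hj ?(orbit_repsK rt) //.
  have -> : h (wreath_incl W A (t z)) = sd_incl C (t z) by apply: hi.
  by rewrite j_conjV tP.
have [w w1] := W_nontrivial.
have /(gmulf_commute h) : commute (wreath_inj W A x w) (wreath_inj W A y w).
  by apply: wreath_inj_commute; apply/eqP.
rewrite /commute !h_inj -!gmulfM => /(congr1 (@sd_ker _ _ _)) /=.
move=> /(congr1 (fun u : F => u (x, y))).
rewrite -[LHS]/(f x w (x, y) * f y w (x, y)).
rewrite -[RHS]/(f y w (x, y) * f x w (x, y)).
rewrite /f; case: pselect => [[]//|_] /=; rewrite !eqxx; case: eqP => // _.
rewrite /e1 /e2 wreath_inj_conj => /mulIg.
move=> /(congr1 (fun s : P => (sd_ker s : dsum W W) 1)) /=.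
rewrite mulg1 eqxx; case: eqP => [w1'|_]; [by case: w1|exact: w1].
Qed.

End Finite.
Lemma wreath_fp_necessary (x0 : X) : (exists w : W, w <> 1) ->
    finitely_presented (wreath W A) ->
  [/\ finitely_presented W /\ finitely_presented G,
      forall x : X, finitely_generated (stabilizer A x)
    & finitely_many_orbits (diag_gset A)].
Proof.
move=> W_nontrivial wr_fp.
have G_fp := wreath_top_fp wr_fp; have wr_fg := finitely_presented_fg wr_fp.
have /finitely_generatedP[n [a a_surj]] := wreath_base_fg x0 wr_fg.
have fO := wreath_orbits_finite W_nontrivial wr_fg.
have V_fp := free_group_fp n.
(* The argument is repeated for each [x], chosen as the representative of its own orbit, since it
   treats the stabilizer of a representative. *)
suff main x : [/\ finitely_presented W, finitely_generated (stabilizer A x)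
                & finitely_many_orbits (diag_gset A)].
  by have [W_fp _ ?] := main x0; split=> // x; have [] := main x.
have [r [t [rt rx /(_ fO) r_finite]]] := orbit_reps_exists A x.
have [D fD [Dvalid Dpres]] :=
  wreath_fp_finite_relations rt a_surj r_finite G_fp V_fp wr_fp.
split.
- exact (wreath_base_fp rx a_surj fD Dvalid Dpres).
- exact (wreath_stabilizer_fg rx a_surj W_nontrivial fD Dvalid Dpres).
- exact (wreath_diag_orbits_finite x rt r_finite a_surj W_nontrivial fD Dvalid
    Dpres).
Qed.

End Necessity.

Theorem theorem1p1 (G W : groupType) (X : Type) (A : gset G X)
    (W_nontrivial : exists w : W, w <> 1%g) (X_nonempty : [set: X] !=set0) :
  finitely_presented (wreath W A) <->
  [/\ finitely_presented W /\ finitely_presented G,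
      forall x : X, finitely_generated (stabilizer A x)
    & finitely_many_orbits (diag_gset A)].
Proof.
have [x0 _] := X_nonempty; split=> [|[[W_fp G_fp] stab_fg fO]].
  (* [{classic X}] equips the arbitrary type [X] with the [choiceType] structure that the lemmas
     assume. *)
  exact: (@wreath_fp_necessary _ _ {classic X}).
exact: (@wreath_fp _ _ {classic X} A x0).
Qed.
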